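(* Let $X$ and $W$ be independent, radially-symmetric, unimodal $\mathbb{R}^d$-valued random vectors, and let $T:\mathbb{R}^d\to\mathbb{R}^d$ be a contraction. Then $$f_{X+W}\preceq f_{T(X)+W},$$ and consequently $h_\alpha(T(X)+W)\le h_\alpha(X+W)$ for all $\alpha\in(0,\infty)$.
   Context: A contraction is a $1$-Lipschitz map for the Euclidean norm. $f_Y$ denotes the density of a random vector $Y$ with respect to Lebesgue measure on $\mathbb{R}^d$. A random vector with density $f$ is unimodal if $\{f>t\}$ is convex for every $t\in\mathbb{R}$. Rényi entropy: for $Y$ with density $f$, $h_\alpha(Y)=\frac{1}{1-\alpha}\log\int_{\mathbb{R}^d} f^\alpha$ for $\alpha\in(0,1)\cup(1,\infty)$, and $h_1(Y)=-\int f\log f$ (natural logarithm). Rearrangement and majorization: for a Borel set $A$ of positive finite volume, $A^*$ is the open Euclidean ball centered at $0$ with the same volume as $A$. For a nonnegative measurable $f$ vanishing at infinity, its symmetrically decreasing rearrangement $f^*$ is the (a.e. unique) function with $\{f^*>t\}=\{f>t\}^*$ for all $t>0$. For probability densities $f,g$ on $\mathbb{R}^d$, $f\preceq g$ (''$f$ is majorized by $g$'') means $\int_{B(0,r)}f^*\,dx\le\int_{B(0,r)}g^*\,dx$ for all $r>0$, where $B(0,r)$ is the open Euclidean ball of radius $r$ centered at $0$. *)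

(* Defs.v *)
From HB Require Import structures.
From mathcomp Require Import all_boot all_order all_algebra.
From mathcomp Require Import all_classical all_reals all_analysis measurable_realfun.

Set Implicit Arguments.
Unset Strict Implicit.
Unset Printing Implicit Defensive.

Import Order.TTheory GRing.Theory Num.Theory.
Import numFieldNormedType.Exports.

Local Open Scope classical_set_scope.
Local Open Scope ring_scope.
Local Open Scope ereal_scope.

(* R^d is 'rV[R]_d, with the sigma-algebra generated by the coordinates (as the
   library does for d.-tuple R), i.e. the Borel sigma-algebra.  The library norm
   on 'rV[R]_d is the sup norm, hence enorm below. *)
Section measurable_rV.
Context (R : realType) (n : nat).

Let coors : 'I_n -> 'rV[R]_n -> R := fun i x => x ord0 i.

Let rV_set0 : g_sigma_preimage coors set0.
Proof. exact: sigma_algebra0. Qed.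

Let rV_setC A : g_sigma_preimage coors A -> g_sigma_preimage coors (~` A).
Proof. exact: sigma_algebraC. Qed.

Let rV_bigcup (F : _^nat) : (forall i, g_sigma_preimage coors (F i)) ->
  g_sigma_preimage coors (\bigcup_i (F i)).
Proof. exact: sigma_algebra_bigcup. Qed.

HB.instance Definition _ := @isMeasurable.Build default_measure_display
  'rV[R]_n (g_sigma_preimage coors) rV_set0 rV_setC rV_bigcup.

Lemma measurable_coord (i : 'I_n) :
  measurable_fun [set: 'rV[R]_n] (fun x : 'rV[R]_n => x ord0 i).
Proof.
move=> _ Y mY; rewrite setTI; apply: sub_sigma_algebra => /=.
rewrite -bigcup_seq/=; exists i => /=; first by rewrite mem_index_enum.
by exists Y => //; rewrite setTI.
Qed.

Lemma measurable_fun_rVP d' (T : measurableType d') (f : T -> 'rV[R]_n) :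
  measurable_fun [set: T] f <->
  forall i, measurable_fun [set: T] (fun t => f t ord0 i).
Proof.
split=> [mf i|mf].
  exact: (measurableT_comp (measurable_coord i) mf).
move=> _ A mA; rewrite setTI.
suff: g_sigma_preimage coors `<=` [set A | measurable (f @^-1` A)] by exact.
apply: smallest_sub.
  split=> [|B mB|F mF] /=.
  - by rewrite preimage_set0.
  - by rewrite setTD preimage_setC; exact: (measurableC mB).
  - by rewrite preimage_bigcup; apply: bigcup_measurable => k _; exact: mF.
rewrite -bigcup_seq; apply: bigcup_sub => i _ _ [B mB <-] /=.
rewrite setTI; have := mf i measurableT B mB; rewrite setTI.
exact.
Qed.

End measurable_rV.

Section lebesgue_rV.
Context (R : realType).

Definition rV_cons (d : nat) (p : R * 'rV[R]_d) : 'rV[R]_d.+1 :=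
  \row_i oapp (fun j => p.2 ord0 j) p.1 (unlift ord0 i).

Definition rV_uncons (d : nat) (x : 'rV[R]_d.+1) : R * 'rV[R]_d :=
  (x ord0 ord0, \row_i x ord0 (lift ord0 i)).

Fixpoint lebesgue_rV (d : nat) : set 'rV[R]_d -> \bar R :=
  match d with
  | 0%N => dirac (0%R : 'rV[R]_0)
  | d'.+1 => pushforward (@lebesgue_measure R \x lebesgue_rV (d := d'))
               (@rV_cons d')
  end.

Lemma rV_cons0 d (p : R * 'rV[R]_d) : rV_cons p ord0 ord0 = p.1.
Proof. by rewrite mxE unlift_none. Qed.

Lemma rV_consS d (p : R * 'rV[R]_d) i :
  rV_cons p ord0 (lift ord0 i) = p.2 ord0 i.
Proof. by rewrite mxE liftK. Qed.

Lemma rV_consK d : cancel (@rV_cons d) (@rV_uncons d).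
Proof.
case=> x v; rewrite /rV_uncons rV_cons0/=; congr pair.
by apply/rowP => i; rewrite mxE rV_consS.
Qed.

Lemma rV_unconsK d : cancel (@rV_uncons d) (@rV_cons d).
Proof.
move=> v; apply/rowP => i; have [j ->|->] := unliftP ord0 i; last first.
  by rewrite rV_cons0.
by rewrite rV_consS/= mxE.
Qed.

Lemma measurable_rV_cons d : measurable_fun setT (@rV_cons d).
Proof.
apply/measurable_fun_rVP => i; have [j ->|->] := unliftP ord0 i; last first.
  by apply: (eq_measurable_fun fst) => [p _|]//; rewrite rV_cons0.
apply: (eq_measurable_fun (fun p : R * 'rV[R]_d => p.2 ord0 j)) => [p _|].
  by rewrite rV_consS.
exact: (measurableT_comp (measurable_coord j) measurable_snd).
Qed.

Lemma measurable_rV_uncons d : measurable_fun setT (@rV_uncons d).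
Proof.
apply/measurable_fun_pairP; split; first exact: measurable_coord.
apply/measurable_fun_rVP => i.
apply: (eq_measurable_fun (fun x : 'rV[R]_d.+1 => x ord0 (lift ord0 i))).
  by move=> x _; rewrite /= mxE.
exact: measurable_coord.
Qed.

Section cons_measure.
Context (d : nat) (mu : {sigma_finite_measure set 'rV[R]_d -> \bar R}).

Definition cons_measure : set 'rV[R]_d.+1 -> \bar R :=
  pushforward (@lebesgue_measure R \x mu) (@rV_cons d).

Let cons_measure0 : cons_measure set0 = 0.
Proof. by rewrite /cons_measure /pushforward preimage_set0 measure0. Qed.

Let cons_measure_ge0 A : 0 <= cons_measure A.
Proof. by rewrite /cons_measure /pushforward; exact: measure_ge0. Qed.

Let cons_measure_sigma_additive : semi_sigma_additive cons_measure.
Proof.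
move=> F mF tF mUF; rewrite /cons_measure /pushforward preimage_bigcup.
apply: measure_semi_sigma_additive.
- by move=> n; rewrite -[X in measurable X]setTI; exact: measurable_rV_cons.
- apply/trivIsetP => /= i j _ _ ij; rewrite -preimage_setI.
  by move/trivIsetP : tF => /(_ _ _ _ _ ij) ->//; rewrite preimage_set0.
- by rewrite -preimage_bigcup -[X in measurable X]setTI; exact: measurable_rV_cons.
Qed.

HB.instance Definition _ := isMeasure.Build _ _ _ cons_measure
  cons_measure0 cons_measure_ge0 cons_measure_sigma_additive.

Let cons_measure_sigma_finite : sigma_finite setT cons_measure.
Proof.
have /sigma_finiteP[F [TF ndF Foo]] := sigma_finiteT (@lebesgue_measure R).
have /sigma_finiteP[G [TG ndG Goo]] := sigma_finiteT mu.
exists (fun n => @rV_uncons d @^-1` (F n `*` G n)).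
  rewrite -preimage_bigcup (_ : \bigcup_i _ = setT) ?preimage_setT//.
  rewrite -setXTT TF TG predeqE => -[x y]; split.
    by move=> [n _ []/= ? ?]; split; exists n.
  move=> [/= [n _ Fnx] [k _ Gky]]; exists (maxn n k) => //; split.
  - by move: x Fnx; exact/subsetPset/ndF/leq_maxl.
  - by move: y Gky; exact/subsetPset/ndG/leq_maxr.
move=> k; have [mF Fk] := Foo k; have [mG Gk] := Goo k; split.
  rewrite -[X in measurable X]setTI; apply: measurable_rV_uncons => //.
  exact: measurableX.
rewrite /cons_measure /pushforward -comp_preimage (_ : _ \o _ = id).
  by rewrite preimage_id product_measure1E// lte_mul_pinfty// ge0_fin_numE.
by apply/funext => p; exact: rV_consK.
Qed.

HB.instance Definition _ := Measure_isSigmaFinite.Build _ _ _ cons_measure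
  cons_measure_sigma_finite.

End cons_measure.

Let lebesgue_rV_measure d :
  exists mu : {sigma_finite_measure set 'rV[R]_d -> \bar R},
    lebesgue_rV (d := d) = mu.
Proof.
elim: d => [|d [mu IH]].
  pose nu : {finite_measure set 'rV[R]_0 -> \bar R} := dirac (0%R : 'rV[R]_0).
  by exists nu.
by exists (cons_measure mu); rewrite /= IH.
Qed.

Section instances.
Context (d : nat).

Let lebesgue_rV0 : lebesgue_rV (d := d) set0 = 0.
Proof. by have [mu ->] := lebesgue_rV_measure d; exact: measure0. Qed.

Let lebesgue_rV_ge0 A : 0 <= lebesgue_rV (d := d) A.
Proof. by have [mu ->] := lebesgue_rV_measure d; exact: measure_ge0. Qed.

Let lebesgue_rV_sigma_additive : semi_sigma_additive (lebesgue_rV (d := d)).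
Proof.
by have [mu ->] := lebesgue_rV_measure d; exact: measure_semi_sigma_additive.
Qed.

HB.instance Definition _ := isMeasure.Build _ _ _ (lebesgue_rV (d := d))
  lebesgue_rV0 lebesgue_rV_ge0 lebesgue_rV_sigma_additive.

Let lebesgue_rV_sigma_finite : sigma_finite setT (lebesgue_rV (d := d)).
Proof. by have [mu ->] := lebesgue_rV_measure d; exact: sigma_finiteT. Qed.

HB.instance Definition _ := Measure_isSigmaFinite.Build _ _ _
  (lebesgue_rV (d := d)) lebesgue_rV_sigma_finite.

End instances.

Lemma measurable_rV_box d (A : 'I_d -> set R) :
  (forall i, measurable (A i)) ->
  measurable [set x : 'rV[R]_d | forall i, A i (x ord0 i)].
Proof.
move=> mA; rewrite (_ : [set x | _] = \bigcap_(i in [set: 'I_d])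
    ((fun x : 'rV[R]_d => x ord0 i) @^-1` A i)).
  apply: fin_bigcap_measurable => // i _.
  by rewrite -[X in measurable X]setTI; exact: measurable_coord.
by apply/seteqP; split=> x /= Ax i; [move=> _|]; exact: Ax.
Qed.

Lemma lebesgue_rV_box d (A : 'I_d -> set R) : (forall i, measurable (A i)) ->
  lebesgue_rV [set x : 'rV[R]_d | forall i, A i (x ord0 i)] =
  \prod_(i < d) @lebesgue_measure R (A i).
Proof.
elim: d A => [A _|d IH A mA].
  rewrite big_ord0 (_ : [set x | _] = setT); first by rewrite /= diracT.
  by apply/seteqP; split=> // x _ [].
rewrite big_ord_recl /= /pushforward.
rewrite (_ : _ @^-1` _ = A ord0 `*`
    [set x : 'rV[R]_d | forall i : 'I_d, A (lift ord0 i) (x ord0 i)]).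
  rewrite product_measure1E; [|exact: (mA ord0)|]; last first.
    exact: (measurable_rV_box (A := fun i => A (lift ord0 i))).
  by congr (_ * _); apply: (IH (fun i => A (lift ord0 i))).
apply/seteqP; split=> -[x v] /=.
  move=> H; split; first by have := H ord0; rewrite rV_cons0.
  by move=> i; have := H (lift ord0 i); rewrite rV_consS.
move=> [Ax Av] i; have [j ->|->] := unliftP ord0 i.
  by rewrite rV_consS; exact: Av.
by rewrite rV_cons0.
Qed.

End lebesgue_rV.

Section definitions.
Context (R : realType) (d : nat).
Implicit Types (x y : 'rV[R]_d) (A B : set 'rV[R]_d) (f g : 'rV[R]_d -> \bar R).

Definition enorm x : R := Num.sqrt (\sum_(i < d) x ord0 i ^+ 2)%R.

Definition eball (r : R) : set 'rV[R]_d := [set x | (enorm x < r)%R].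

Definition euclidean_contraction (T : 'rV[R]_d -> 'rV[R]_d) : Prop :=
  forall x y, (enorm (T x - T y) <= enorm (x - y))%R.

Definition radially_symmetric f : Prop :=
  forall x y, enorm x = enorm y -> f x = f y.

(* Densities are valued in [0, +oo], so that an unbounded density can have a
   representative with convex superlevel sets (it is then +oo at the center). *)
Definition unimodal f : Prop :=
  forall t : R, convex_set ([set x | t%:E < f x] : set (convex_lmodType 'rV[R]_d)).

(* B is A^*.  When A is negligible the radius is 0 and B is empty. *)
Definition is_set_rearrangement A B : Prop :=
  exists2 r : R, (0 <= r)%R & B = eball r /\ lebesgue_rV B = lebesgue_rV A.

(* fs is f^*: the nonnegative function fs is determined by its superlevel sets
   at positive levels. *)
Definition is_rearrangement f (fs : 'rV[R]_d -> \bar R) : Prop :=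
  (forall x, 0 <= fs x) /\
  forall t : R, (0 < t)%R ->
    is_set_rearrangement [set x | t%:E < f x] [set x | t%:E < fs x].

Definition majorized f g : Prop :=
  exists fs gs : 'rV[R]_d -> \bar R,
    [/\ is_rearrangement f fs, is_rearrangement g gs &
        forall r : R, (0 < r)%R ->
          \int[@lebesgue_rV R d]_(x in eball r) fs x <=
          \int[@lebesgue_rV R d]_(x in eball r) gs x].

(* Conventions: 0 * lne 0 = 0, lne +oo = +oo, and the integral of f log f is
   (+oo) - (+oo) = -oo when both its positive and negative parts have infinite
   integral, i.e. an undefined Shannon entropy is +oo. *)
Definition renyi_entropy (alpha : R) f : \bar R :=
  if alpha == 1%R then - \int[@lebesgue_rV R d]_x (f x * lne (f x))
  else ((1 - alpha)^-1)%:E * lne (\int[@lebesgue_rV R d]_x (f x `^ alpha)).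

End definitions.

Section random_vectors.
Context d0 (Omega : measurableType d0) (R : realType) (P : probability Omega R).
Context (d : nat).

Definition has_density (Y : Omega -> 'rV[R]_d) (f : 'rV[R]_d -> \bar R) : Prop :=
  [/\ measurable_fun [set: Omega] Y, measurable_fun [set: 'rV[R]_d] f,
      forall x, 0 <= f x &
      forall A, measurable A ->
        P (Y @^-1` A) = \int[@lebesgue_rV R d]_(x in A) f x].

Definition independent_vectors (X Y : Omega -> 'rV[R]_d) : Prop :=
  forall A B, measurable A -> measurable B ->
    P (X @^-1` A `&` Y @^-1` B) = P (X @^-1` A) * P (Y @^-1` B).

End random_vectors.

(* Main.v *)
(* Write [phi_h a = E h(a + W)].  If [h] is radially decreasing then so is [phi_h]:
   the convolution of two radially decreasing functions is radially decreasing,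
   as one sees by comparing its values at [z1] and [z2], [|z1| <= |z2|], through
   the reflection exchanging [z1] and [z2].  After translating so that [T 0 = 0]
   we have [|T x| <= |x|], whence [E h(X + W) = E phi_h(X) <= E phi_h(T X) =
   E h(T X + W)], and the reverse inequality for radially increasing [h].
   Since [f = f_{X+W}] is itself radially decreasing, taking for [h] the indicator
   of a ball gives the majorization.  The entropy inequalities follow from
   tangent-line inequalities [phi(g) >= phi(f) + phi'(f) (g - f)], because
   [phi'(f)] is radially monotone. *)
Require Import Defs.
From mathcomp Require Import all_boot all_order all_algebra.
From mathcomp Require Import all_classical all_reals all_analysis measurable_realfun.
From mathcomp Require Import ring lra.

Set Implicit Arguments.
Unset Strict Implicit.
Unset Printing Implicit Defensive.

Import Order.TTheory GRing.Theory Num.Theory.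
Import numFieldNormedType.Exports.

Local Open Scope classical_set_scope.
Local Open Scope ring_scope.
Local Open Scope ereal_scope.

(** * Translation invariance of Lebesgue measure *)

(** Three obstacles shape the argument. First, [T] may collapse the space, so T(X) may have no
    density; the density of T(X) + W is therefore [image_conv], an average of translates of [fW]
    weighted by [fX]. Second, densities take values in [0, +oo] and their power and logarithmic
    integrals may diverge. Inequalities are thus stated between sums of nonnegative terms, and a
    term is cancelled only once its integral is known to be finite: by truncation when alpha > 1, by
    a bound on the negative part of g log g when alpha = 1. Third, f_{T(X)+W} need not be radial, so
    the integral of its rearrangement over a ball is not computed but only bounded below, by the
    integral of the density over a translate of that ball. The geometric input is the invariance of
    Lebesgue measure under reflections. The measure is built coordinate by coordinate, which gives
    translation invariance by induction on the dimension; a Haar uniqueness argument then yields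
    reflections and, applied to dilations, the volumes of balls. *)

Lemma pushforward_measure_exists d1 d2 (X : measurableType d1)
    (Y : measurableType d2) (R : realType) (phi : X -> Y)
    (mu : {measure set X -> \bar R}) : measurable_fun [set: X] phi ->
  exists m : {measure set Y -> \bar R}, m = pushforward mu phi :> (set Y -> \bar R).
Proof.
by move=> mphi; unshelve eexists (pushforward mu phi).
Qed.

Section measurability.
Context (R : realType) (n : nat).

Definition dotp (x y : 'rV[R]_n) : R := (\sum_(i < n) x ord0 i * y ord0 i)%R.

Context d (T : measurableType d).
Implicit Types f g : T -> 'rV[R]_n.

Lemma measurable_rVD f g : measurable_fun setT f -> measurable_fun setT g ->
  measurable_fun setT (fun t => (f t + g t)%R).
Proof.
move=> /measurable_fun_rVP mf /measurable_fun_rVP mg.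
apply/measurable_fun_rVP => i; apply: (eq_measurable_fun
  (fun t => f t ord0 i + g t ord0 i)%R) => [t _|]; first by rewrite mxE.
exact: measurable_funD.
Qed.

Lemma measurable_rVZ (h : T -> R) f :
  measurable_fun setT h -> measurable_fun setT f ->
  measurable_fun setT (fun t => (h t *: f t)%R).
Proof.
move=> mh /measurable_fun_rVP mf.
apply/measurable_fun_rVP => i; apply: (eq_measurable_fun
  (fun t => h t * f t ord0 i)%R) => [t _|]; first by rewrite mxE.
exact: measurable_funM.
Qed.

Lemma measurable_rVN f : measurable_fun setT f ->
  measurable_fun setT (fun t => (- f t)%R).
Proof.
move=> mf; under eq_fun do rewrite -scaleN1r.
exact: measurable_rVZ.
Qed.

Lemma measurable_rVB f g : measurable_fun setT f -> measurable_fun setT g ->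
  measurable_fun setT (fun t => (f t - g t)%R).
Proof. by move=> mf mg; apply: measurable_rVD => //; exact: measurable_rVN. Qed.

Lemma measurable_dotp f g : measurable_fun setT f -> measurable_fun setT g ->
  measurable_fun setT (fun t => dotp (f t) (g t)).
Proof.
move=> /measurable_fun_rVP mf /measurable_fun_rVP mg.
by apply: measurable_sum => i; apply: measurable_funM.
Qed.

Lemma measurable_enorm f : measurable_fun setT f ->
  measurable_fun setT (fun t => enorm (f t)).
Proof.
move=> mf; apply: (measurableT_comp (continuous_measurable_fun (@sqrt_continuous R)) _).
under eq_fun do under eq_bigr do rewrite expr2.
exact: (measurable_dotp mf mf).
Qed.

End measurability.

Section translation.
Context (R : realType).

(** The pushforward by a translation agrees with Lebesgue measure on half-open intervals, and these
    determine it. *)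
Lemma lebesgue_measure_translation (a : R) (A : set R) : measurable A ->
  @lebesgue_measure R ((fun x => x + a)%R @^-1` A) = @lebesgue_measure R A.
Proof.
have mphi : measurable_fun [set: measurableTypeR R]
    ((fun x => x + a)%R : measurableTypeR R -> measurableTypeR R).
  exact: measurable_funD.
have [m mE] := pushforward_measure_exists (@lebesgue_measure R) mphi.
move=> mA; have : m A = lebesgue_measure A; last by rewrite mE.
apply/esym/lebesgue_measure_unique => // _ [[x y]] _ <-; rewrite mE /pushforward.
rewrite (_ : _ @^-1` _ = `]x - a, y - a]%classic)%R; last first.
  by apply/seteqP; split=> z; rewrite /= !in_itv/= => /andP[? ?]; apply/andP; split; lra.
rewrite lebesgue_measure_itv [RHS]lebesgue_measure_itv/= !lte_fin ltrD2r; case: ifPn => // _.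
by rewrite -!EFinB; congr (_%:E); lra.
Qed.

Lemma lebesgue_rV_translation d (a : 'rV[R]_d) A : measurable A ->
  lebesgue_rV ((fun x => x + a)%R @^-1` A) = lebesgue_rV A.
Proof.
elim: d a A => [a A mA|d IH a A mA].
  rewrite (_ : _ @^-1` A = A)//; apply/seteqP; split => x /=;
  by rewrite (_ : (x + a)%R = x)//; apply/rowP => -[].
pose a' := (rV_uncons a).2; pose a0 := a ord0 ord0.
pose B := @rV_cons R d @^-1` A.
have mB : measurable B.
  by rewrite -[B]setTI; exact: measurable_rV_cons.
have shB : @rV_cons R d @^-1` ((fun x => x + a)%R @^-1` A) =
    [set p | B (p.1 + a0, p.2 + a')%R].
  apply/seteqP; split => -[x v]; rewrite /B/= => H; have : (rV_cons (x, v) + a)%R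
    = rV_cons (x + a0, v + a')%R; try by [move=> <-|move=> ->].
    apply/rowP => i; rewrite mxE; have [j ->|->] := unliftP ord0 i.
      by rewrite !rV_consS/= !mxE.
    by rewrite !rV_cons0.
  apply/rowP => i; rewrite mxE; have [j ->|->] := unliftP ord0 i.
    by rewrite !rV_consS/= !mxE.
  by rewrite !rV_cons0.
rewrite /= /pushforward shB /product_measure1.
have mk : measurable_fun [set: measurableTypeR R] (fun x => lebesgue_rV (xsection B x)).
  exact: (measurable_fun_xsection (@lebesgue_rV R d)).
(* The induction hypothesis absorbs the shift of the last coordinates slice by slice; the shift [a0]
   of the first coordinate is left to the one-dimensional case. *)
transitivity (\int[@lebesgue_measure R]_x (lebesgue_rV (xsection B (x + a0)%R))).
  apply: eq_integral => x _ /=.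
  rewrite -(IH a' (xsection B _)); last exact: measurable_xsection.
  by congr lebesgue_rV; apply/seteqP; split => v; rewrite /xsection/= !inE.
have mphi : measurable_fun [set: measurableTypeR R]
    ((fun x => x + a0)%R : measurableTypeR R -> measurableTypeR R).
  exact: measurable_funD.
rewrite -[LHS](ge0_integral_pushforward mphi lebesgue_measure (D := setT)
  (f := fun x => lebesgue_rV (xsection B x)))//.
apply: eq_measure_integral => C mC _.
exact: lebesgue_measure_translation.
Qed.

End translation.

(** * Linear isometries and volumes of balls *)

Lemma measurable_preimageT d1 d2 (T1 : measurableType d1)
    (T2 : measurableType d2) (f : T1 -> T2) (B : set T2) :
  measurable_fun setT f -> measurable B -> measurable (f @^-1` B).
Proof. by move=> mf mB; rewrite -[X in measurable X]setTI; exact: mf. Qed.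

Section measure_preserving.
Context (R : realType) (d : nat).
Local Notation mu := (@lebesgue_rV R d).

Lemma ge0_integral_preserving (phi : 'rV[R]_d -> 'rV[R]_d) D
    (f : 'rV[R]_d -> \bar R) :
  measurable_fun setT phi ->
  (forall A, measurable A -> mu (phi @^-1` A) = mu A) ->
  measurable D -> measurable_fun setT f -> (forall x, 0 <= f x) ->
  \int[mu]_(x in phi @^-1` D) f (phi x) = \int[mu]_(x in D) f x.
Proof.
move=> mphi phimu mD mf f0.
rewrite -[LHS](ge0_integral_pushforward mphi mu (D := D) (f := f))//.
  by apply: eq_measure_integral => A mA _; exact: phimu.
exact: measurable_funTS.
Qed.

Lemma measurable_shift (a : 'rV[R]_d) :
  measurable_fun setT (fun x : 'rV[R]_d => (x + a)%R : 'rV[R]_d).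
Proof. exact: measurable_rVD. Qed.

Lemma ge0_integral_shift (a : 'rV[R]_d) D (f : 'rV[R]_d -> \bar R) :
  measurable D -> measurable_fun setT f -> (forall x, 0 <= f x) ->
  \int[mu]_(x in (fun x => x + a)%R @^-1` D) f (x + a)%R = \int[mu]_(x in D) f x.
Proof.
apply: (ge0_integral_preserving (phi := fun x => x + a)%R).
  exact: measurable_shift.
by move=> A mA; exact: lebesgue_rV_translation.
Qed.

(** Both sides are measures of [C] that agree on rectangles, so uniqueness of the product measure
    identifies them. *)
Lemma lebesgue_rV_section_exchange (C : set ('rV[R]_d * 'rV[R]_d)) :
  measurable C ->
  \int[mu]_x mu (xsection C x) = \int[mu]_y mu (ysection C y).
Proof.
move=> mC; apply: (product_measure_unique (m1 := mu) (m2 := mu)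
  (m' := product_measure2 mu mu)) => // A B mA mB.
exact: product_measure2E.
Qed.

(* Uniqueness of Haar measure, applied to the image of [mu] by [s]. *)
Lemma lebesgue_rV_additive_map (s : 'rV[R]_d -> 'rV[R]_d) E A :
  measurable_fun setT s -> {morph s : x y / (x + y)%R} ->
  (forall x, exists y, s y = x) -> measurable E -> measurable A ->
  mu E * mu (s @^-1` A) = mu [set y | E (- s y)%R] * mu A.
Proof.
move=> ms sD ssurj mE mA.
(* The shear (x, y) -> (x + s y, y) carries [C] onto [C']. Slices at fixed x split each measure into
   one of the two products; slices at fixed y show that the two measures agree. *)
pose C := [set p : 'rV[R]_d * 'rV[R]_d | E p.1 /\ A (p.1 + s p.2)%R].
pose C' := [set p : 'rV[R]_d * 'rV[R]_d | E (p.1 - s p.2)%R /\ A p.1].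
have ms2 : measurable_fun setT (fun p : 'rV[R]_d * 'rV[R]_d => s p.2).
  by apply: measurableT_comp => //; exact: measurable_snd.
have mfst : measurable_fun setT (fun p : 'rV[R]_d * 'rV[R]_d => p.1).
  exact: measurable_fst.
have mC : measurable C.
  apply: measurableI; first exact: (measurable_preimageT mfst mE).
  exact: (measurable_preimageT (measurable_rVD mfst ms2) mA).
have mC' : measurable C'.
  apply: measurableI; last exact: (measurable_preimageT mfst mA).
  exact: (measurable_preimageT (measurable_rVB mfst ms2) mE).
have CE x : mu (xsection C x) = (\1_E x)%:E * mu (s @^-1` A).
  rewrite indicE; have [xE|xE] := boolP (x \in E); last first.
    rewrite mul0e (_ : xsection C x = set0) ?measure0//.
    apply/seteqP; split => // y; rewrite /xsection/= inE/= => -[Ex _].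
    by move/negP: xE; apply; rewrite inE.
  (* Writing x = s a turns the slice into the translate by [a] of the preimage of [A]; this is where
     surjectivity enters. *)
  rewrite mul1e; have [a sa] := ssurj x.
  rewrite -(lebesgue_rV_translation a (A := s @^-1` A)); last first.
    exact: (measurable_preimageT ms mA).
  congr lebesgue_rV; apply/seteqP; split => y;
  rewrite /xsection/= inE /C/= sD sa addrC; first by case.
  by split => //; rewrite inE in xE.
have C'E x : mu (xsection C' x) = mu [set y | E (- s y)%R] * (\1_A x)%:E.
  rewrite indicE; have [xA|xA] := boolP (x \in A); last first.
    rewrite mule0 (_ : xsection C' x = set0) ?measure0//.
    apply/seteqP; split => // y; rewrite /xsection/= inE/= => -[_ Ax].
    by move/negP: xA; apply; rewrite inE.
  rewrite mule1; have [a sa] := ssurj (- x)%R.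
  rewrite -(lebesgue_rV_translation a (A := [set y | E (- s y)%R])); last first.
    exact: (measurable_preimageT (measurable_rVN ms) mE).
  congr lebesgue_rV; apply/seteqP; split => y;
  rewrite /xsection/= inE /C'/= sD sa opprD opprK addrC; first by case.
  by split => //; rewrite inE in xA.
have iE B : measurable B -> \int[mu]_x (\1_B x)%:E = mu B.
  by move=> mB; rewrite integral_indic// setIT.
have m1 B : measurable B -> measurable_fun setT (fun x : 'rV[R]_d => (\1_B x : R)%:E).
  by move=> mB; apply/measurable_EFinP; exact: measurable_indic.
transitivity (\int[mu]_x mu (xsection C x)).
  under eq_integral do rewrite CE.
  by rewrite ge0_integralZr//= ?iE//; exact: m1.
transitivity (\int[mu]_x mu (xsection C' x)); last first.
  under eq_integral do rewrite C'E.
  by rewrite ge0_integralZl//= ?iE//; exact: m1.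
rewrite !lebesgue_rV_section_exchange//; apply: eq_integral => y _.
rewrite -(lebesgue_rV_translation (s y) (A := ysection C' y)); last first.
  exact: measurable_ysection.
congr lebesgue_rV; apply/seteqP; split => x;
by rewrite /ysection/= !inE /C /C'/= addrK.
Qed.

End measure_preserving.

(** * Inner product, Euclidean norm and reflections *)

Section euclidean.
Context (R : realType) (d : nat).
Implicit Types (x y z : 'rV[R]_d).

Lemma dotpC x y : dotp x y = dotp y x.
Proof. by apply: eq_bigr => i _; rewrite mulrC. Qed.

Lemma dotpDl x y z : dotp (x + y)%R z = (dotp x z + dotp y z)%R.
Proof. by rewrite -big_split/=; apply: eq_bigr => i _; rewrite mxE mulrDl. Qed.

Lemma dotpZl (a : R) x y : dotp (a *: x)%R y = (a * dotp x y)%R.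
Proof. by rewrite mulr_sumr; apply: eq_bigr => i _; rewrite mxE mulrA. Qed.

Lemma dotpDr x y z : dotp x (y + z)%R = (dotp x y + dotp x z)%R.
Proof. by rewrite dotpC dotpDl !(dotpC x). Qed.

Lemma dotpZr (a : R) x y : dotp x (a *: y)%R = (a * dotp x y)%R.
Proof. by rewrite dotpC dotpZl dotpC. Qed.

Lemma dotpNl x y : dotp (- x)%R y = (- dotp x y)%R.
Proof. by rewrite -scaleN1r dotpZl mulN1r. Qed.

Lemma dotpNr x y : dotp x (- y)%R = (- dotp x y)%R.
Proof. by rewrite dotpC dotpNl dotpC. Qed.

Lemma dotp_ge0 x : (0 <= dotp x x)%R.
Proof. by apply: sumr_ge0 => i _; rewrite -expr2 sqr_ge0. Qed.

Lemma dotp_eq0 x : (dotp x x == 0)%R = (x == 0%R).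
Proof.
apply/idP/eqP => [|->]; last by rewrite /dotp big1// => i _; rewrite mxE mul0r.
rewrite psumr_eq0 => [/allP H|i _]; last by rewrite -expr2 sqr_ge0.
apply/rowP => i; have := H i (mem_index_enum _).
by rewrite -expr2 sqrf_eq0 mxE => /eqP.
Qed.

Lemma enormE x : enorm x = Num.sqrt (dotp x x).
Proof. by rewrite /enorm; under eq_bigr do rewrite expr2. Qed.

Lemma enorm_ge0 x : (0 <= enorm x)%R.
Proof. exact: sqrtr_ge0. Qed.

Lemma sqr_enorm x : (enorm x ^+ 2)%R = dotp x x.
Proof. by rewrite enormE sqr_sqrtr// dotp_ge0. Qed.

Lemma ler_enorm x y : (enorm x <= enorm y)%R = (dotp x x <= dotp y y)%R.
Proof. by rewrite !enormE ler_psqrt// nnegrE dotp_ge0. Qed.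

Lemma enorm_eq x y : dotp x x = dotp y y -> enorm x = enorm y.
Proof. by rewrite !enormE => ->. Qed.

Lemma enorm0 : enorm (0 : 'rV[R]_d)%R = 0%R.
Proof. by apply/eqP; rewrite enormE sqrtr_eq0 le_eqVlt dotp_eq0 eqxx. Qed.

Lemma enorm_eq0 x : (enorm x == 0)%R = (x == 0%R).
Proof. by rewrite -dotp_eq0 -sqr_enorm sqrf_eq0. Qed.

Lemma enormN x : enorm (- x)%R = enorm x.
Proof. by apply: enorm_eq; rewrite dotpNl dotpNr opprK. Qed.

Lemma enormB x y : enorm (x - y)%R = enorm (y - x)%R.
Proof. by rewrite -enormN opprB. Qed.

Lemma enormZ (a : R) x : enorm (a *: x)%R = (`|a| * enorm x)%R.
Proof.
by rewrite !enormE dotpZl dotpZr mulrA -expr2 sqrtrM ?sqr_ge0// sqrtr_sqr.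
Qed.

Lemma ler_coord_enorm x i : (`|x ord0 i| <= enorm x)%R.
Proof.
rewrite enormE -sqrtr_sqr ler_wsqrtr// /dotp (bigD1 i)//= expr2 lerDl.
by apply: sumr_ge0 => j _; rewrite -expr2 sqr_ge0.
Qed.

(** The bound rests on d < (d + 1)^2; dividing by [d.+1] keeps it strict and meaningful in dimension
    0. *)
Lemma enorm_lt_coord x (e : R) : (0 < e)%R ->
  (forall i, `|x ord0 i| < e / d.+1%:R)%R -> (enorm x < e)%R.
Proof.
move=> e0 H; rewrite -(ger0_norm (enorm_ge0 x)) -[ltRHS](ger0_norm (ltW e0)).
rewrite -ltr_sqr ?nnegrE// !real_normK ?num_real// sqr_enorm.
have d0 : (0 < d.+1%:R :> R)%R by rewrite ltr0n.
apply: (@le_lt_trans _ _ (\sum_(i < d) (e / d.+1%:R) ^+ 2)%R).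
  apply: ler_sum => i _; rewrite -expr2 -[leLHS]real_normK ?num_real//.
  by rewrite lerXn2r ?nnegrE// ?divr_ge0// ?ltW.
rewrite sumr_const card_ord expr_div_n -[X in (X < _)%R]mulr_natr mulrAC.
rewrite ltr_pdivrMr ?exprn_gt0// ltr_pM2l ?exprn_gt0//.
rewrite -natrX ltr_nat expnS expn1.
by apply: (@leq_trans d.+1) => //; rewrite leq_pmulr.
Qed.

(* For [n = 0], where [0^-1 = 0], this is the identity. *)
Definition reflection (n x : 'rV[R]_d) : 'rV[R]_d :=
  (x - (2 * (dotp x n / dotp n n)) *: n)%R.

Lemma reflectionD n : {morph reflection n : x y / (x + y)%R}.
Proof.
by move=> x y; rewrite /reflection dotpDl (mulrDl (dotp _ _)) mulrDr scalerDl opprD addrACA.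
Qed.

Lemma dotp_reflection n x : dotp (reflection n x) (reflection n x) = dotp x x.
Proof.
have [->|n0] := eqVneq n 0%R; first by rewrite /reflection scaler0 subr0.
rewrite /reflection !(dotpDl, dotpDr, dotpNl, dotpNr, dotpZl, dotpZr).
rewrite -dotp_eq0 in n0; rewrite (dotpC n x); field.
exact: n0.
Qed.

Lemma reflectionK n : involutive (reflection n).
Proof.
move=> x; have [->|n0] := eqVneq n 0%R; first by rewrite /reflection !scaler0 !subr0.
rewrite -dotp_eq0 in n0; rewrite /reflection.
set k := (2 * (dotp x n / dotp n n))%R.
rewrite (_ : 2 * (dotp (x - k *: n) n / dotp n n) = - k)%R.
  by rewrite scaleNr opprK subrK.
by rewrite dotpDl dotpNl dotpZl /k; field.
Qed.

Lemma measurable_reflection n : measurable_fun setT (reflection n).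
Proof.
apply: measurable_rVB => //; apply: measurable_rVZ => //.
apply: measurable_funM => //; apply: measurable_funM => //.
exact: measurable_dotp.
Qed.

End euclidean.

(** * Volumes of balls and invariance under reflections *)

Section balls.
Context (R : realType) (d : nat).
Local Notation mu := (@lebesgue_rV R d).

Lemma measurable_eball (r : R) : measurable (@eball R d r).
Proof.
rewrite (_ : eball r = (@enorm R d) @^-1` `]-oo, r[%classic); last first.
  by apply/seteqP; split => x /=; rewrite in_itv.
rewrite -[X in measurable X]setTI; apply: measurable_enorm => //.
Qed.

(** Cubes are the sets of explicitly known volume; balls are controlled by comparison with them. *)
Lemma lebesgue_rV_cube (e : R) : (0 <= e)%R ->
  mu [set x : 'rV[R]_d | forall i, `](- e)%R, e[%classic (x ord0 i)] = ((2 * e) ^+ d)%:E.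
Proof.
move=> e0; rewrite (lebesgue_rV_box (A := fun=> `](- e)%R, e[%classic))//.
rewrite (eq_bigr (fun=> (2 * e)%:E)) => [|i _].
  by rewrite prodEFin prodr_const card_ord.
rewrite lebesgue_measure_itv/= lte_fin; case: ifPn => [_|].
  by rewrite -EFinB opprK; congr (_%:E); lra.
by rewrite -leNgt => H; congr (_%:E); lra.
Qed.

Lemma lebesgue_rV_eball_fin (r : R) : mu (eball r) < +oo.
Proof.
pose e : R := Num.max r 0%R.
apply: (@le_lt_trans _ _ (mu [set x : 'rV[R]_d | forall i, `](- e)%R, e[%classic (x ord0 i)])).
  apply: le_measure; rewrite ?inE; first exact: measurable_eball.
    exact: (measurable_rV_box (A := fun=> `](- e)%R, e[%classic)).
  move=> x /= xr i; rewrite in_itv/= -ltr_norml.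
  apply: le_lt_trans (ler_coord_enorm x i) _.
  by rewrite /e lt_max xr.
by rewrite lebesgue_rV_cube ?ltry// /e le_max lexx orbT.
Qed.

Lemma lebesgue_rV_eball_gt0 (r : R) : (0 < r)%R -> 0 < mu (eball r).
Proof.
move=> r0; pose e : R := (r / d.+1%:R)%R.
have e0 : (0 < e)%R by rewrite divr_gt0// ltr0n.
apply: (@lt_le_trans _ _ (mu [set x : 'rV[R]_d | forall i, `](- e)%R, e[%classic (x ord0 i)])).
  by rewrite lebesgue_rV_cube ?(ltW e0)// lte_fin exprn_gt0// mulr_gt0.
apply: le_measure; rewrite ?inE; last 2 first.
- exact: measurable_eball.
- move=> x /= H; apply: enorm_lt_coord => // i.
  by have := H i; rewrite in_itv/= -ltr_norml.
exact: (measurable_rV_box (A := fun=> `](- e)%R, e[%classic)).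
Qed.

(** In the identity for additive maps, take [E] to be the unit ball: it is preserved by x -> -
    reflection x, and its volume, finite and positive, cancels. *)
Lemma lebesgue_rV_reflection (n : 'rV[R]_d) A : measurable A ->
  mu (reflection n @^-1` A) = mu A.
Proof.
move=> mA; have c0 := lebesgue_rV_eball_gt0 (@ltr01 R).
have := lebesgue_rV_additive_map (measurable_reflection n) (@reflectionD _ _ n)
  (fun x => ex_intro _ (reflection n x) (reflectionK n x))
  (@measurable_eball 1%R) mA.
rewrite (_ : [set y | _] = eball 1%R); last first.
  apply/seteqP; split => x; rewrite /eball/= enormN;
  by rewrite (enorm_eq (dotp_reflection n x)).
have [c cn0 ->] : exists2 c, c != 0%R & mu (eball 1%R) = c%:E.
  exists (fine (mu (eball 1%R))).
    by rewrite gt_eqF// fine_gt0// c0 lebesgue_rV_eball_fin.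
  by rewrite fineK// ge0_fin_numE// lebesgue_rV_eball_fin.
move/(congr1 (fun z => (c^-1)%:E * z)).
by rewrite !muleA -!EFinM mulVf// !mul1e.
Qed.

(** The identity for additive maps, applied to division by [r] with [E] the unit ball and [A] the
    cube [Q 1], equates the ratio of the ball volumes with the ratio (2r)^d / 2^d of the cube
    volumes. *)
Lemma lebesgue_rV_eball (r : R) : (0 < r)%R ->
  mu (eball r) = (r ^+ d)%:E * mu (eball 1%R).
Proof.
move=> r0; pose s (x : 'rV[R]_d) := (r^-1 *: x)%R.
have ms : measurable_fun setT s by exact: measurable_rVZ.
have sD : {morph s : x y / (x + y)%R} by move=> x y; rewrite /s scalerDr.
have ssurj x : exists y, s y = x.
  by exists (r *: x)%R; rewrite /s scalerA mulVf ?scale1r// gt_eqF.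
pose Q (e : R) := [set x : 'rV[R]_d | forall i, `](- e)%R, e[%classic (x ord0 i)].
have mQ e : measurable (Q e) by exact: (measurable_rV_box (A := fun=> `](- e)%R, e[%classic)).
have := lebesgue_rV_additive_map ms sD ssurj (@measurable_eball 1%R) (mQ 1%R).
rewrite (_ : s @^-1` Q 1%R = Q r); last first.
  apply/seteqP; split => x; rewrite /Q/= => H i; have := H i;
  rewrite /= !in_itv/= -!ltr_norml mxE normrM gtr0_norm ?invr_gt0//;
  by rewrite mulrC ltr_pdivrMr// mul1r.
rewrite (_ : [set y | _] = eball r); last first.
  apply/seteqP; split => x; rewrite /eball/= enormN enormZ gtr0_norm ?invr_gt0//;
  by rewrite mulrC ltr_pdivrMr// mul1r.
rewrite !lebesgue_rV_cube ?ler01// ?(ltW r0)// mulr1 exprMn.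
move/(congr1 (fun c => c * ((2 ^+ d)^-1)%:E)).
rewrite -!muleA -!EFinM mulfV ?mule1; last by rewrite expf_neq0.
by rewrite mulrAC mulfV ?mul1r ?expf_neq0// => <-; rewrite muleC.
Qed.

End balls.

(** * Radial monotonicity of convolutions *)

Section contraction.
Context (R : realType) (d : nat).

Lemma rat_rV_dense (x : 'rV[R]_d) (e : R) : (0 < e)%R ->
  exists q : 'rV[rat]_d, (enorm (x - map_mx ratr q) < e)%R.
Proof.
move=> e0; have : (0 < e / d.+1%:R)%R by rewrite divr_gt0// ltr0n.
have := @enorm_lt_coord R d _ e e0; move: (e / d.+1%:R)%R => c coord c0.
have H i : exists q : rat, (`|x ord0 i - ratr q| < c)%R.
  have : (x ord0 i - c < x ord0 i + c)%R by lra.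
  move=> /rat_in_itvoo[q]; rewrite in_itv/= => /andP[q1 q2]; exists q.
  by rewrite ltr_norml; apply/andP; split; lra.
exists (\row_i xchoose (H i)); apply: coord => i.
by rewrite !mxE; exact: xchooseP (H i).
Qed.

(** Each coordinate of [T] is 1-Lipschitz, hence at x it is the supremum over rational points q of
    (T q)_i - |x - q|; its superlevel sets are countable unions of measurable sets. *)
Lemma measurable_contraction (T : 'rV[R]_d -> 'rV[R]_d) :
  euclidean_contraction T -> measurable_fun setT T.
Proof.
move=> cT; apply/measurable_fun_rVP => i.
move=> _; apply: (measurability _ (RGenOInfty.measurableE R)) => // _ [_ [a ->] <-].
rewrite setTI (_ : _ @^-1` _ = \bigcup_(q in [set: 'rV[rat]_d])
    [set x | (a < T (map_mx ratr q) ord0 i - enorm (x - map_mx ratr q))%R]).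
  apply: countable_bigcupT_measurable => [|q]; first exact: countableP.
  rewrite (_ : [set x | _] = (fun x => T (map_mx ratr q) ord0 i -
    enorm (x - map_mx ratr q))%R @^-1` `]a, +oo[%classic); last first.
    by apply/seteqP; split => x /=; rewrite in_itv/= andbT.
  apply: measurable_preimageT => //; apply: measurable_funB => //.
  by apply: measurable_enorm; exact: measurable_rVB.
have coord x y : (T y ord0 i - T x ord0 i <= enorm (x - y))%R.
  rewrite enormB; apply: (le_trans _ (cT y x)).
  apply: (le_trans _ (ler_coord_enorm (T y - T x)%R i)).
  by rewrite !mxE ler_norm.
apply/seteqP; split => x /=; rewrite in_itv/= andbT; last first.
  by move=> [q _ /= H]; have := coord x (map_mx ratr q); lra.
(* Half the gap, because |x - q| is lost twice: once in passing from T x to T q, once in the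
   subtracted term. *)
move=> ax; have e0 : (0 < (T x ord0 i - a) / 2)%R by rewrite divr_gt0// subr_gt0.
have [q xq] := rat_rV_dense x e0.
exists q => //=; have := coord (map_mx ratr q) x; rewrite enormB; lra.
Qed.

End contraction.

Section radial_monotonicity.
Context (R : realType) (d : nat).
Local Notation mu := (@lebesgue_rV R d).
Implicit Types (u v f : 'rV[R]_d -> \bar R) (x y z : 'rV[R]_d).

Definition radially_decreasing f :=
  forall x y, (enorm x <= enorm y)%R -> f y <= f x.

Definition radially_increasing f :=
  forall x y, (enorm x <= enorm y)%R -> f x <= f y.

Lemma radially_decreasing_symmetric f : radially_decreasing f -> radially_symmetric f.
Proof. by move=> H x y xy; apply/eqP; rewrite eq_le !H// xy. Qed.

(* A superlevel set containing [y] contains [-y], hence the whole segment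
   between them, which has points of every norm up to that of [y]. *)
Lemma unimodal_radially_decreasing f : (forall x, 0 <= f x) ->
  radially_symmetric f -> unimodal f -> radially_decreasing f.
Proof.
move=> f0 fsym funi x y xy; rewrite leNgt; apply/negP => fxy.
have fxfin : f x \is a fin_num by rewrite ge0_fin_numE// (lt_le_trans fxy)// leey.
have [y0|y0] := eqVneq y 0%R.
  move: fxy; rewrite (fsym x y) ?ltxx//; apply/eqP; rewrite eq_le xy/= y0 enorm0.
  exact: enorm_ge0.
have ny : (0 < enorm y)%R by rewrite lt_neqAle eq_sym enorm_eq0 y0 enorm_ge0.
(* The point [c *: y] has the norm of [x] and is the convex combination of [y] and [- y] with weight
   (1 + c) / 2 on [y]. *)
pose c := (enorm x / enorm y)%R.
have c0 : (0 <= c)%R by rewrite divr_ge0 ?enorm_ge0.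
have c1 : (c <= 1)%R by rewrite ler_pdivrMr// mul1r.
have l0 : (0 <= (1 + c) / 2)%R by lra.
have l1 : ((1 + c) / 2 <= 1)%R by lra.
have inS w : enorm w = enorm y -> w \in [set z | (fine (f x))%:E < f z].
  by move=> wy; rewrite inE/= (fsym w y)// fineK.
have := funi (fine (f x)) y (- y)%R (Itv01 l0 l1) (inS _ erefl) (inS _ (enormN y)).
set w := conv _ _ _; have -> : w = (c *: y)%R.
  transitivity ((1 + c) / 2 *: y + (1 - (1 + c) / 2) *: - y)%R; first by [].
  by rewrite scalerN -scalerBl; congr (_ *: _)%R; field.
by rewrite inE/= fineK// (fsym _ x) ?ltxx// enormZ ger0_norm// divfK// gt_eqF.
Qed.

(* The reflection exchanging [z1] and [z2] moves a point away from the origin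
   whenever it is closer to [z1] than to [z2]. *)
Lemma swap_reflection z1 z2 : (enorm z1 <= enorm z2)%R ->
  exists s : 'rV[R]_d -> 'rV[R]_d,
  [/\ measurable_fun setT s,
      (forall A, measurable A -> mu (s @^-1` A) = mu A),
      (forall x, enorm (z1 - s x) = enorm (z2 - x)),
      (forall x, enorm (z2 - s x) = enorm (z1 - x)) &
      forall x, (enorm (z1 - x) <= enorm (z2 - x) /\ enorm x <= enorm (s x) \/
                 enorm (z2 - x) <= enorm (z1 - x) /\ enorm (s x) <= enorm x)%R].
Proof.
rewrite ler_enorm => z12.
(* This form of the reflection across the bisecting hyperplane makes |z1 - s x| = |z2 - x|
   immediate; if z1 = z2, then n = 0 and [s] is the identity. *)
pose n := (z2 - z1)%R; pose s x := (z1 - reflection n (z2 - x))%R.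
have nE : reflection n n = (- n)%R.
  have [->|n0] := eqVneq n 0%R; first by rewrite /reflection scaler0 oppr0 addr0.
  by rewrite /reflection mulfV ?dotp_eq0// mulr1 scaler_nat mulr2n opprD addNKr.
have ms : measurable_fun setT s.
  apply: measurable_rVB => //.
  apply: (measurableT_comp (measurable_reflection n)) => //.
  exact: measurable_rVB.
exists s; split => //.
- move=> A mA; pose b := (z1 - reflection n z2)%R.
  have reflN x : reflection n (- x)%R = (- reflection n x)%R.
    by rewrite /reflection dotpNl mulNr mulrN scaleNr opprB addrC opprK.
  have sE x : s x = (reflection n x + b)%R.
    by rewrite /s reflectionD reflN opprB addrCA addrC -addrA addrC.
  rewrite -(lebesgue_rV_translation b mA) -(lebesgue_rV_reflection n
    (measurable_preimageT (measurable_shift b) mA)).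
  by congr lebesgue_rV; apply/seteqP; split => x /=; rewrite sE.
- by move=> x; rewrite /s opprB addrC subrK (enorm_eq (dotp_reflection n _)).
- move=> x; rewrite (_ : z2 - s x = reflection n (z1 - x))%R.
    by rewrite (enorm_eq (dotp_reflection n _)).
  rewrite /s (_ : z1 - x = z2 - x - n)%R; last first.
    by rewrite /n; apply/rowP => i; rewrite !mxE; ring.
  have reflNn : reflection n (- n)%R = n by rewrite -nE reflectionK.
  move: (z2 - x)%R => w; rewrite reflectionD reflNn /n.
  by rewrite opprB addrCA addrA.
(* [D] is |z2 - x|^2 - |z1 - x|^2, and |s x|^2 - |x|^2 is a nonnegative multiple of it, so the sign
   of [D] decides both comparisons at once. *)
- move=> x; pose D := (dotp z2 z2 - dotp z1 z1 - 2 * dotp x n)%R.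
  have D1 : (dotp (z2 - x) (z2 - x) - dotp (z1 - x) (z1 - x) = D)%R.
    rewrite /D /n !(dotpDl, dotpDr, dotpNl, dotpNr) (dotpC z1 x) (dotpC z2 x).
    by ring.
  have D2 : (dotp (s x) (s x) - dotp x x =
             D * ((dotp z2 z2 - dotp z1 z1) / dotp n n))%R.
    have [n0|n0] := eqVneq n 0%R.
      have zz : z2 = z1 by apply/eqP; rewrite -subr_eq0 -/n n0.
      have -> : s x = x.
        by rewrite /s n0 /reflection !scaler0 subr0 zz opprB addrCA subrr addr0.
      by rewrite zz !subrr mul0r mulr0.
    rewrite -dotp_eq0 in n0.
    pose k := (D / dotp n n)%R.
    have sE : s x = (x + k *: n)%R.
      rewrite /s /reflection.
      have -> : (2 * (dotp (z2 - x) n / dotp n n) = k + 1)%R.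
        rewrite /k /D; move: n0; rewrite /n.
        rewrite !(dotpDl, dotpDr, dotpNl, dotpNr) (dotpC z2 z1).
        by move=> n0; field.
      rewrite scalerDl scale1r /n; apply/rowP => i; rewrite !mxE.
      set K := (k * _)%R; ring.
    have expand (w : 'rV[R]_d) : (dotp (x + k *: w) (x + k *: w) - dotp x x =
        2 * k * dotp x w + k ^+ 2 * dotp w w)%R.
      by rewrite !(dotpDl, dotpDr, dotpZl, dotpZr) (dotpC w x); ring.
    rewrite sE expand.
    have -> : (dotp z2 z2 - dotp z1 z1 = D + 2 * dotp x n)%R.
      by rewrite /D; ring.
    by rewrite /k; field.
  have c0 : (0 <= (dotp z2 z2 - dotp z1 z1) / dotp n n)%R.
    by rewrite divr_ge0 ?dotp_ge0// subr_ge0.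
  rewrite !ler_enorm.
  have [D0|/ltW D0] := leP 0%R D; [left|right]; split.
  + lra.
  + by rewrite -subr_ge0 D2 mulr_ge0.
  + lra.
  + by rewrite -subr_le0 D2 mulr_le0_ge0.
Qed.

(** This is (a - b)(c - e) >= 0 expanded without subtraction, so that it makes sense for infinite
    values. When [a] or [c] is infinite, either both factors of a product vanish suitably or the
    right-hand side is +oo. *)
Lemma rearrangement_ineq (a b c e : \bar R) : 0 <= b -> 0 <= e ->
  b <= a -> e <= c -> b * c + a * e <= a * c + b * e.
Proof.
move=> b0 e0 ba ec.
have a0 := le_trans b0 ba; have c0 := le_trans e0 ec.
have [cy|cy] := eqVneq c +oo.
  have [a_eq0|an0] := eqVneq a 0.
    have -> : b = 0 by apply/eqP; rewrite eq_le b0 -a_eq0 ba.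
    by rewrite a_eq0 !mul0e.
  by rewrite cy (@gt0_muley _ a) ?lt0e ?an0// addye ?leey//
    gt_eqF// (lt_le_trans (ltNyr 0)) ?mule_ge0.
have [ay|ay] := eqVneq a +oo.
  have [c_eq0|cn0] := eqVneq c 0.
    have -> : e = 0 by apply/eqP; rewrite eq_le e0 -c_eq0 ec.
    by rewrite c_eq0 !mule0.
  by rewrite ay (@gt0_mulye _ c) ?lt0e ?cn0// addye ?leey//
    gt_eqF// (lt_le_trans (ltNyr 0)) ?mule_ge0.
have fa : a \is a fin_num by rewrite ge0_fin_numE// ltey.
have fc : c \is a fin_num by rewrite ge0_fin_numE// ltey.
have fb : b \is a fin_num by rewrite ge0_fin_numE// (le_lt_trans ba)// ltey.
have fe : e \is a fin_num by rewrite ge0_fin_numE// (le_lt_trans ec)// ltey.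
move: b0 e0 ba ec; rewrite -(fineK fa) -(fineK fb) -(fineK fc) -(fineK fe).
move: (fine a) (fine b) (fine c) (fine e) => a' b' c' e' b0 e0 ba ec.
rewrite !lee_fin in b0 e0 ba ec; rewrite -!EFinM -!EFinD lee_fin; nra.
Qed.

Definition rV_conv u v z : \bar R := \int[mu]_x (u (z - x)%R * v x).

Lemma measurable_conv_integrand u v z :
  measurable_fun setT u -> measurable_fun setT v ->
  measurable_fun setT (fun x => u (z - x)%R * v x).
Proof.
move=> mum mv; apply: emeasurable_funM => //.
by apply: (measurableT_comp mum); exact: measurable_rVB.
Qed.

(** Folding the integral along the measure-preserving map [s] writes twice the convolution as the
    integral of the values at x and at s x together, so a comparison of pairs suffices. *)
Lemma rV_conv_le u v z z' s :
  measurable_fun setT u -> measurable_fun setT v ->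
  (forall x, 0 <= u x) -> (forall x, 0 <= v x) ->
  measurable_fun setT s -> (forall A, measurable A -> mu (s @^-1` A) = mu A) ->
  (forall x, u (z - x)%R * v x + u (z - s x)%R * v (s x) <=
             u (z' - x)%R * v x + u (z' - s x)%R * v (s x)) ->
  rV_conv u v z <= rV_conv u v z'.
Proof.
move=> mum mv u0 v0 ms smu H.
have dbl w : rV_conv u v w + rV_conv u v w =
    \int[mu]_x (u (w - x)%R * v x + u (w - s x)%R * v (s x)).
  have muv := measurable_conv_integrand w mum mv.
  rewrite ge0_integralD//; first last.
  - exact: (measurableT_comp muv ms).
  - by move=> x _; rewrite mule_ge0.
  - by move=> x _; rewrite mule_ge0.
  congr (_ + _); apply/esym.
  by apply: (ge0_integral_preserving ms smu measurableT muv) => x; rewrite mule_ge0.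
rewrite -(@lee_pmul2l _ 2%:E)// ?lte_fin// !mule_natl !mule2n !dbl.
have mI w : measurable_fun setT
    (fun x => u (w - x)%R * v x + u (w - s x)%R * v (s x)).
  have muv := measurable_conv_integrand w mum mv.
  exact: (emeasurable_funD muv (measurableT_comp muv ms)).
by apply: ge0_le_integral => // x _; rewrite adde_ge0// mule_ge0.
Qed.

(** Of x and s x, the one nearer to [z1] is also nearer to the origin. Centering [u] at [z1] thus
    multiplies the larger value of [u] by the larger value of [v], which maximizes the sum over the
    pair. *)
Lemma rV_conv_decreasing u v :
  measurable_fun setT u -> measurable_fun setT v ->
  (forall x, 0 <= u x) -> (forall x, 0 <= v x) ->
  radially_decreasing u -> radially_decreasing v ->
  radially_decreasing (rV_conv u v).
Proof.
move=> mum mv u0 v0 du dv z1 z2 z12.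
have [s [ms smu s1 s2 scmp]] := swap_reflection z12.
apply: (rV_conv_le mum mv u0 v0 ms smu) => x.
have usym := radially_decreasing_symmetric du.
rewrite (usym _ _ (s1 x)) (usym _ _ (s2 x)).
have [[c1 c2]|[c1 c2]] := scmp x.
  by apply: rearrangement_ineq => //; [exact: du|exact: dv].
rewrite addeC [leRHS]addeC.
by apply: rearrangement_ineq => //; [exact: du|exact: dv].
Qed.

(** The point of the pair nearer to [z1] now carries the smaller value of [v], so the same pairing
    favours [z2]. *)
Lemma rV_conv_increasing u v :
  measurable_fun setT u -> measurable_fun setT v ->
  (forall x, 0 <= u x) -> (forall x, 0 <= v x) ->
  radially_decreasing u -> radially_increasing v ->
  radially_increasing (rV_conv u v).
Proof.
move=> mum mv u0 v0 du iv z1 z2 z12.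
have [s [ms smu s1 s2 scmp]] := swap_reflection z12.
apply: (rV_conv_le mum mv u0 v0 ms smu) => x.
have usym := radially_decreasing_symmetric du.
rewrite (usym _ _ (s1 x)) (usym _ _ (s2 x)).
have [[c1 c2]|[c1 c2]] := scmp x; last first.
  by apply: rearrangement_ineq => //; [exact: du|exact: iv].
rewrite addeC [leRHS]addeC.
by apply: rearrangement_ineq => //; [exact: du|exact: iv].
Qed.

End radial_monotonicity.

(** * Densities of sums *)

Section layer_cake.
Context dd (T : measurableType dd) (R : realType).
Variable k : T -> \bar R.
Hypotheses (mk : measurable_fun setT k) (k0 : forall x, 0 <= k x).

(** Building 0 < t into the set lets the layer cake integral run over the whole line. *)
Definition superlevel (t : R) : set T := [set x | (0 < t)%R /\ t%:E < k x].

Let S : set (T * measurableTypeR R) := [set p | superlevel p.2 p.1].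

Lemma measurable_superlevel t : measurable (superlevel t).
Proof.
have [t0|t0] := pselect (0 < t)%R; last first.
  by rewrite (_ : superlevel t = set0)//; apply/seteqP; split => // x [].
rewrite (_ : superlevel t = [set x | t%:E < k x]); last first.
  by apply/seteqP; split => [x []|x].
by rewrite -[X in measurable X]setTI; exact: emeasurable_fun_o_infty.
Qed.

Let mS : measurable S.
Proof.
have m2 : measurable_fun setT (fun p : T * measurableTypeR R => (p.2 : R)).
  exact: measurable_snd.
rewrite (_ : S = [set p | (0 < p.2)%R] `&` [set p | p.2%:E < k p.1])//.
apply: measurableI.
  rewrite (_ : [set _ | _] = (fun p : T * measurableTypeR R => (p.2 : R)) @^-1`
    `]0%R, +oo[%classic); first exact: measurable_preimageT.
  by apply/seteqP; split => p /=; rewrite in_itv/= andbT.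
rewrite (_ : [set _ | _] = (fun p : T * measurableTypeR R =>
    (p.2%:E < k p.1)) @^-1` [set true]); last first.
  by apply/seteqP; split.
apply: measurable_preimageT => //; apply: measurable_fun_lte.
  by apply/measurable_EFinP.
by apply: (measurableT_comp mk); exact: measurable_fst.
Qed.

Let lebesgue_xsection x : @lebesgue_measure R (xsection S x) = k x.
Proof.
have -> : xsection S x = [set t : R | (0 < t)%R /\ t%:E < k x].
  by apply/seteqP; split => t; rewrite /xsection/= inE.
have := k0 x; case: (k x) => [r| |] // r0.
- rewrite (_ : [set t | _] = `]0%R, r[%classic).
    rewrite lebesgue_measure_itv/= lte_fin; case: ifPn => [_|].
      by rewrite sube0.
    by rewrite lee_fin in r0; rewrite -leNgt => r1; congr (_%:E); lra.
  by apply/seteqP; split => t /=; rewrite in_itv/= lte_fin; [move=> [-> ->]|move/andP].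
- rewrite (_ : [set t | _] = `]0%R, +oo[%classic); first by rewrite lebesgue_measure_itv/= ltry.
  by apply/seteqP; split => t /=; rewrite in_itv/= andbT ltry; [case|].
Qed.

(** The region under the graph of [k] is measured by slicing in both directions; its fibre over x is
    the interval ]0, k x[, of length k x even when that is infinite. *)
Lemma layer_cake (m : {sigma_finite_measure set T -> \bar R}) :
  \int[m]_x k x = \int[@lebesgue_measure R]_t m (superlevel t).
Proof.
transitivity (\int[m]_x (@lebesgue_measure R (xsection S x))).
  by apply: eq_integral => x _; rewrite lebesgue_xsection.
transitivity (\int[@lebesgue_measure R]_t m (ysection S t)).
  apply: (product_measure_unique (m1 := m) (m2 := @lebesgue_measure R)
    (m' := product_measure2 m (@lebesgue_measure R))) => // A B mA mB.
  exact: product_measure2E.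
apply: eq_integral => t _; congr (m _).
by apply/seteqP; split => x; rewrite /ysection/= inE.
Qed.

Lemma measurable_superlevel_measure (m : {sigma_finite_measure set T -> \bar R}) :
  measurable_fun [set: measurableTypeR R] (fun t => m (superlevel t)).
Proof.
rewrite (_ : (fun t => _) = m \o ysection S); first exact: measurable_fun_ysection.
by apply/funext => t /=; congr (m _); apply/seteqP; split => x; rewrite /ysection/= inE.
Qed.

(** Slicing [k] into superlevel sets reduces the claim to the hypothesis on measures of sets;
    Tonelli reassembles the slices into [k]. *)
Lemma integral_density (nu m : {sigma_finite_measure set T -> \bar R})
    (f : T -> \bar R) : measurable_fun setT f -> (forall x, 0 <= f x) ->
  (forall A, measurable A -> nu A = \int[m]_(x in A) f x) ->
  \int[nu]_x k x = \int[m]_x (k x * f x).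
Proof.
move=> mf f0 nuE; rewrite layer_cake.
pose g (p : T * measurableTypeR R) := (\1_S p : R)%:E * f p.1.
have mg : measurable_fun setT g.
  apply: emeasurable_funM; first by apply/measurable_EFinP; exact: measurable_indic.
  by apply: (measurableT_comp mf); exact: measurable_fst.
have g0 p : 0 <= g p by rewrite mule_ge0// lee_fin.
transitivity (\int[@lebesgue_measure R]_t \int[m]_x g (x, t)).
  apply: eq_integral => t _; rewrite nuE; last exact: measurable_superlevel.
  rewrite integral_mkcond; apply: eq_integral => x _.
  rewrite patchE /g indicE/= (_ : ((x, t) \in S) = (x \in superlevel t)).
    by case: ifP => _; rewrite ?mul1e ?mul0e.
  by apply/idP/idP; rewrite !inE.
rewrite -(fubini_tonelli (m1 := m) (m2 := @lebesgue_measure R) g)//.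
apply: eq_integral => x _; rewrite -[in RHS](lebesgue_xsection x).
have mSx := measurable_xsection x mS.
transitivity (\int[@lebesgue_measure R]_t ((\1_(xsection S x) t : R)%:E * f x)).
  by apply: eq_integral => t _; rewrite /g/= !indicE mem_xsection.
rewrite ge0_integralZr//; last first.
  by apply/measurable_EFinP; exact: measurable_indic.
by rewrite integral_indic// setIT.
Qed.

End layer_cake.

Section convolution_density.
Context (R : realType) (d : nat).
Local Notation mu := (@lebesgue_rV R d).
Variables (fX fW : 'rV[R]_d -> \bar R) (T : 'rV[R]_d -> 'rV[R]_d).
Hypotheses (mfX : measurable_fun setT fX) (fX0 : forall x, 0 <= fX x).
Hypotheses (mfW : measurable_fun setT fW) (fW0 : forall x, 0 <= fW x).
Hypothesis mT : measurable_fun setT T.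

(** Formally E fW(z - T(X)), written against the law of X so that T(X) needs no density. For
    [T := id] it is [rV_conv fW fX]. *)
Definition image_conv (z : 'rV[R]_d) : \bar R := \int[mu]_x (fW (z - T x)%R * fX x).

Let measurable_integrand : measurable_fun setT
  (fun p : 'rV[R]_d * 'rV[R]_d => fW (p.1 - T p.2)%R * fX p.2).
Proof.
apply: emeasurable_funM.
  apply: (measurableT_comp mfW); apply: measurable_rVB; first exact: measurable_fst.
  by apply: (measurableT_comp mT); exact: measurable_snd.
by apply: (measurableT_comp mfX); exact: measurable_snd.
Qed.

Let integrand_ge0 (p : 'rV[R]_d * 'rV[R]_d) : 0 <= fW (p.1 - T p.2)%R * fX p.2.
Proof. by rewrite mule_ge0. Qed.

Lemma measurable_image_conv : measurable_fun setT image_conv.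
Proof. exact: (measurable_fun_fubini_tonelli_F (m2 := mu) _ measurable_integrand). Qed.

Lemma image_conv_ge0 z : 0 <= image_conv z.
Proof. by apply: integral_ge0 => x _; exact: (integrand_ge0 (z, x)). Qed.

(** Tonelli. In probabilistic terms both sides are E h(T(X) + W), the right one conditioned on X. *)
Lemma integral_image_conv (h : 'rV[R]_d -> \bar R) :
  measurable_fun setT h -> (forall x, 0 <= h x) ->
  \int[mu]_z (h z * image_conv z) =
  \int[mu]_x (\int[mu]_z (h z * fW (z - T x)%R) * fX x).
Proof.
move=> mh h0.
pose g (p : 'rV[R]_d * 'rV[R]_d) := h p.1 * (fW (p.1 - T p.2)%R * fX p.2).
have mg : measurable_fun setT g.
  apply: emeasurable_funM => //.
  by apply: (measurableT_comp mh); exact: measurable_fst.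
have g0 p : 0 <= g p by rewrite mule_ge0.
transitivity (\int[mu]_z \int[mu]_x g (z, x)).
  apply: eq_integral => z _; rewrite /image_conv -ge0_integralZl//.
  - exact: (measurableT_comp measurable_integrand
      (measurable_fun_pair (measurable_cst z) (@measurable_id _ _ _))).
  - by move=> x _; exact: (integrand_ge0 (z, x)).
rewrite (fubini_tonelli (m1 := mu) (m2 := mu) g)//.
apply: eq_integral => x _; rewrite /g/=.
rewrite -ge0_integralZr//.
- by apply: eq_integral => z _; rewrite muleA.
- apply: emeasurable_funM => //; apply: (measurableT_comp mfW).
  exact: measurable_rVB.
- by move=> z _; rewrite mule_ge0.
Qed.

End convolution_density.

Section density_of_sum.
Context d0 (Omega : measurableType d0) (R : realType) (P : probability Omega R).
Context (d : nat) (X W : {RV P >-> 'rV[R]_d}) (fX fW : 'rV[R]_d -> \bar R).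
Context (T : 'rV[R]_d -> 'rV[R]_d).
Local Notation mu := (@lebesgue_rV R d).

Lemma has_density_image_conv : independent_vectors P X W ->
  has_density P X fX -> has_density P W fW -> measurable_fun setT T ->
  has_density P (fun w => T (X w) + W w)%R (image_conv fX fW T).
Proof.
move=> indep [mX mfX fX0 XE] [mW mfW fW0 WE] mT.
have mTX : measurable_fun setT (fun w => T (X w)) := measurableT_comp mT mX.
split; first exact: measurable_rVD.
- exact: measurable_image_conv.
- exact: image_conv_ge0.
move=> A mA.
pose C := [set p : 'rV[R]_d * 'rV[R]_d | A (T p.1 + p.2)%R].
have mC : measurable C.
  apply: (measurable_preimageT
    (f := fun p : 'rV[R]_d * 'rV[R]_d => (T p.1 + p.2)%R)) => //.
  apply: measurable_rVD; last exact: measurable_snd.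
  by apply: (measurableT_comp mT); exact: measurable_fst.
(* Independence says that the joint law [m] is a product on rectangles; uniqueness of product
   measures extends this to [C], whose slice at x is the event that W lies in A - T x. *)
have [m mE] := pushforward_measure_exists P (measurable_fun_pair mX mW).
have m_prod B1 B2 : measurable B1 -> measurable B2 ->
    m (B1 `*` B2) = distribution P X B1 * distribution P W B2.
  by move=> mB1 mB2; rewrite mE; exact: indep.
have /= := product_measure_unique m_prod mC.
rewrite mE /pushforward/= => <-.
pose k x := \int[mu]_z ((\1_A z : R)%:E * fW (z - T x)%R).
have m1A : measurable_fun setT (fun z : 'rV[R]_d => (\1_A z : R)%:E).
  by apply/measurable_EFinP; exact: measurable_indic.
have kE x : distribution P W (xsection C x) = k x.
  rewrite /distribution/= /pushforward WE; last exact: measurable_xsection.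
  transitivity (\int[mu]_(z in A) fW (z - T x)%R).
    rewrite -(ge0_integral_shift (T x) mA)//; last first.
      by apply: (measurableT_comp mfW); exact: measurable_rVB.
    rewrite (_ : xsection C x = (fun z => z + T x)%R @^-1` A); last first.
      by apply/seteqP; split => z; rewrite /xsection/= inE /C/= addrC.
    by apply: eq_integral => z _; rewrite addrK.
  rewrite integral_mkcond; apply: eq_integral => z _; rewrite patchE indicE.
  by case: ifP => _; rewrite ?mul1e ?mul0e.
have k0 x : 0 <= k x by apply: integral_ge0 => z _; rewrite mule_ge0// lee_fin.
have mk : measurable_fun setT k.
  rewrite (_ : k = distribution P W \o xsection C); last first.
    by apply/funext => x; rewrite -kE.
  exact: measurable_fun_xsection.
rewrite /product_measure1/=; under eq_integral do rewrite kE.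
rewrite (integral_density mk k0 (m := mu) mfX)//.
rewrite -[LHS](integral_image_conv mfX fX0 mfW fW0 mT m1A); last first.
  by move=> x; rewrite lee_fin.
rewrite [RHS]integral_mkcond; apply: eq_integral => z _; rewrite patchE indicE.
by case: ifP => _; rewrite ?mul1e ?mul0e.
Qed.

End density_of_sum.

Section comparison.
Context (R : realType) (d : nat).
Local Notation mu := (@lebesgue_rV R d).
Variables (fX fW : 'rV[R]_d -> \bar R).
Hypotheses (mfX : measurable_fun setT fX) (fX0 : forall x, 0 <= fX x).
Hypotheses (mfW : measurable_fun setT fW) (fW0 : forall x, 0 <= fW x).
Hypotheses (dX : radially_decreasing fX) (dW : radially_decreasing fW).

Lemma image_conv_decreasing : radially_decreasing (image_conv fX fW id).
Proof. exact: (rV_conv_decreasing mfW mfX). Qed.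

Variable T : 'rV[R]_d -> 'rV[R]_d.
Hypotheses (mT : measurable_fun setT T) (T_le : forall x, (enorm (T x) <= enorm x)%R).

(** Since [fW] is even, the inner integral E h(S x + W) is the convolution [rV_conv fW h] at S x, to
    which the radial monotonicity applies. *)
Let integral_image_conv_rV_conv S (h : 'rV[R]_d -> \bar R) :
  measurable_fun setT S -> measurable_fun setT h -> (forall x, 0 <= h x) ->
  \int[mu]_z (h z * image_conv fX fW S z) =
  \int[mu]_x (rV_conv fW h (S x) * fX x).
Proof.
move=> mS mh h0; rewrite (integral_image_conv mfX fX0 mfW fW0 mS mh h0).
apply: eq_integral => x _.
congr (_ * _); apply: eq_integral => z _; rewrite muleC; congr (_ * _).
by apply: radially_decreasing_symmetric => //; rewrite enormB.
Qed.

Let measurable_rV_conv S h : measurable_fun setT S -> measurable_fun setT h ->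
  (forall x, 0 <= h x) ->
  measurable_fun setT (fun x => rV_conv fW h (S x) * fX x).
Proof.
move=> mS mh h0; apply: emeasurable_funM => //.
apply: (measurableT_comp _ mS).
exact: (measurable_image_conv mh h0 mfW fW0 (T := id)).
Qed.

Let rV_conv_ge0 h x : (forall x, 0 <= h x) -> 0 <= rV_conv fW h x.
Proof. by move=> h0; apply: integral_ge0 => z _; rewrite mule_ge0. Qed.

Lemma integral_radially_decreasing (h : 'rV[R]_d -> \bar R) :
  measurable_fun setT h -> (forall x, 0 <= h x) -> radially_decreasing h ->
  \int[mu]_z (h z * image_conv fX fW id z) <= \int[mu]_z (h z * image_conv fX fW T z).
Proof.
move=> mh h0 dh; have ET := integral_image_conv_rV_conv mT mh h0.
have Eid := integral_image_conv_rV_conv (S := id) (@measurable_id _ _ _) mh h0.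
rewrite [leLHS]Eid [leRHS]ET.
apply: ge0_le_integral => //.
- by move=> x _; rewrite mule_ge0// rV_conv_ge0.
- exact: (measurable_rV_conv (S := id)).
- exact: measurable_rV_conv.
- by move=> x _; rewrite lee_wpmul2r//; apply: rV_conv_decreasing.
Qed.

Lemma integral_radially_increasing (h : 'rV[R]_d -> \bar R) :
  measurable_fun setT h -> (forall x, 0 <= h x) -> radially_increasing h ->
  \int[mu]_z (h z * image_conv fX fW T z) <= \int[mu]_z (h z * image_conv fX fW id z).
Proof.
move=> mh h0 dh; have ET := integral_image_conv_rV_conv mT mh h0.
have Eid := integral_image_conv_rV_conv (S := id) (@measurable_id _ _ _) mh h0.
rewrite [leLHS]ET [leRHS]Eid.
apply: ge0_le_integral => //.
- by move=> x _; rewrite mule_ge0// rV_conv_ge0.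
- exact: measurable_rV_conv.
- exact: (measurable_rV_conv (S := id)).
- by move=> x _; rewrite lee_wpmul2r//; apply: rV_conv_increasing.
Qed.

End comparison.

(** * Entropy comparison *)

Section radial_measurability.
Context (R : realType) (d : nat).
Implicit Types h : 'rV[R]_d -> \bar R.

(** A superlevel set is the preimage under the norm of an interval of radii. The lemmas below take
    for it the downward or upward closure of the norms attained on that superlevel set. *)
Let measurable_radial h (I : R -> set R) : (forall t, is_interval (I t)) ->
  (forall t x, I t (enorm x) <-> t%:E < h x) -> measurable_fun setT h.
Proof.
move=> itvI hI _; apply: (measurability _ (ErealGenOInfty.measurableE R)) => //.
move=> _ [_ [t ->] <-]; rewrite setTI.
rewrite (_ : _ @^-1` _ = (@enorm R d) @^-1` I t); last first.
  by apply/seteqP; split => x /=; rewrite in_itv/= andbT hI.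
apply: measurable_preimageT; first exact: measurable_enorm.
exact: is_interval_measurable.
Qed.

Lemma measurable_radially_decreasing h : radially_decreasing h -> measurable_fun setT h.
Proof.
move=> dh; apply: (measurable_radial (I := fun t =>
    [set r | exists2 y, (r <= enorm y)%R & t%:E < h y])).
  move=> t r1 r2 _ [y r2y ty] r /andP[_ rr2]; exists y => //.
  exact: le_trans rr2 r2y.
move=> t x; split=> [[y xy ty]|tx]; last by exists x.
exact: lt_le_trans ty (dh _ _ xy).
Qed.

Lemma measurable_radially_increasing h : radially_increasing h -> measurable_fun setT h.
Proof.
move=> ih; apply: (measurable_radial (I := fun t =>
    [set r | exists2 y, (enorm y <= r)%R & t%:E < h y])).
  move=> t r1 r2 [y r1y ty] _ r /andP[r1r _]; exists y => //.
  exact: le_trans r1y r1r.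
move=> t x; split=> [[y xy ty]|tx]; last by exists x.
exact: lt_le_trans ty (ih _ _ xy).
Qed.

End radial_measurability.

(** * Tangent-line inequalities on [0, +oo] *)

Section pointwise_inequalities.
Context (R : realType).
Implicit Types (x y : \bar R) (a b t : R).

Lemma measurable_lne : measurable_fun [set: \bar R] (@lne R).
Proof.
move=> _; apply: (measurability _ (ErealGenOInfty.measurableE R)) => //.
move=> _ [_ [t ->] <-]; rewrite setTI.
rewrite (_ : _ @^-1` _ = `](expR t)%:E, +oo[%classic).
  exact: emeasurable_itv.
apply/seteqP; split=> -[r| |] /=; rewrite !in_itv/= ?andbT ?ltry//.
- case: ifPn => // r0; rewrite !lte_fin => tr.
  by rewrite -ltNge in r0; rewrite -[r]lnK ?posrE// ltr_expR.
- rewrite lte_fin => tr; have r0 := lt_trans (expR_gt0 t) tr.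
  by rewrite leNgt r0/= lte_fin -ltr_expR lnK ?posrE.
Qed.

(** Young's inequality for the product of t^a and 1, with conjugate exponents 1/a and 1/(1 - a). *)
Lemma powR_le_tangent a t : (0 < a < 1)%R -> (0 <= t)%R ->
  (t `^ a <= a * t + (1 - a))%R.
Proof.
move=> /andP[a0 a1] t0.
have := @conjugate_powR R (t `^ a)%R 1%R a^-1%R (1 - a)^-1%R (powR_ge0 _ _) ler01.
rewrite !invr_gt0 subr_gt0 !invrK mulr1 powR1 -powRrM mulfV ?gt_eqF// powRr1//.
rewrite mulrC mul1r; apply => //; lra.
Qed.

(** Young's inequality for t * 1 with conjugate exponents a and a/(a - 1), multiplied by [a]. *)
Lemma powR_ge_tangent a t : (1 < a)%R -> (0 <= t)%R ->
  (a * t <= t `^ a + (a - 1))%R.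
Proof.
move=> a1 t0; have a0 : (0 < a)%R by lra.
have := @conjugate_powR R t 1%R a (a / (a - 1))%R t0 ler01 a0.
rewrite divr_gt0 ?subr_gt0// invf_div mulr1 powR1 mul1r => /(_ isT).
have -> : (a^-1 + (a - 1) / a = 1)%R by field; rewrite gt_eqF.
move=> /(_ erefl); rewrite -mulrDl ler_pdivlMr// mulrC; exact.
Qed.

(** The inequality ln u <= u - 1 at u = b / a, multiplied by [a]. *)
Lemma ln_ge_tangent a b : (0 < a)%R -> (0 < b)%R -> (a * ln b + a - b <= a * ln a)%R.
Proof.
move=> a0 b0; have ba : (0 < b / a)%R by rewrite divr_gt0.
have := @le_ln1Dx R (b / a - 1)%R.
rewrite addrCA subrr addr0 ltrBrDl subrr => /(_ ba).
rewrite ln_div ?posrE// -(ler_pM2l a0) mulrBr mulrBr mulrCA mulfV ?gt_eqF//; lra.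
Qed.

(** The tangent at [x] evaluated at [y]. The slope x^(a-1) is written as the inverse of x^(1-a),
    which gives +oo at x = 0 and 0 at x = +oo. *)
Lemma poweR_le_tangent x y a : (0 < a < 1)%R -> 0 <= x -> 0 <= y ->
  y `^ a <= a%:E * ((x `^ (1 - a))^-1 * y) + (1 - a)%:E * x `^ a.
Proof.
move=> a01; have /andP[a0 a1] := a01; have a'0 : (0 < 1 - a)%R by lra.
case: x => [x| |]// x0; last first.
  move=> y0; rewrite !poweRyr ?gt_eqF// invey mul0e mule0 add0e.
  by rewrite gt0_muley ?leey// lte_fin.
rewrite lee_fin in x0.
have [->|xn0] := eqVneq x 0%R.
  rewrite poweR0r ?gt_eqF// inve0 poweR0r ?gt_eqF// mule0 adde0.
  case: y => [y| |]//; last by rewrite gt0_mulye// gt0_muley ?leey// lte_fin.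
  rewrite le_eqVlt => /predU1P[[<-]|y0]; first by rewrite poweR0r ?gt_eqF// !mule0.
  by rewrite gt0_mulye// gt0_muley ?leey// lte_fin.
have xp : (0 < x)%R by rewrite lt_neqAle eq_sym xn0.
have p0 : (0 < x `^ (1 - a))%R by rewrite powR_gt0.
rewrite poweR_EFin inver gt_eqF//.
case: y => [y| |]//; last first.
  move=> _; rewrite gt0_muley ?lte_fin ?invr_gt0// gt0_muley ?lte_fin//.
  by rewrite addye ?leey// gt_eqF// (lt_le_trans (ltNyr 0))// mule_ge0 ?poweR_ge0// lee_fin ltW.
rewrite lee_fin => y0; rewrite !poweR_EFin -!EFinM -EFinD lee_fin.
(* By homogeneity, the tangent at 1 evaluated at y / x and scaled by x^a is the tangent at x. *)
have yxE : ((y / x) `^ a * x `^ a = y `^ a)%R.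
  by rewrite -powRM ?divr_ge0// divfK.
have /(ler_wpM2r (powR_ge0 x a)) := powR_le_tangent a01 (divr_ge0 y0 x0).
rewrite yxE mulrDl.
rewrite (_ : a * (y / x) * x `^ a = a * ((x `^ (1 - a))^-1 * y))%R//.
rewrite -!mulrA; congr (_ * _)%R; rewrite mulrC; congr (_ * _)%R.
rewrite -powRN -{1}(powRr1 x0) -powRN -powRD; last by rewrite xn0 implybT.
by congr (_ `^ _)%R; ring.
Qed.

(** The point of tangency is a finite real because the lemma is applied at a truncated density; the
    negative term of the tangent stands on the right. *)
Lemma poweR_ge_tangent a t y : (1 < a)%R -> (0 <= t)%R -> 0 <= y ->
  a%:E * ((t `^ (a - 1))%:E * y) <= y `^ a + ((a - 1) * t `^ a)%:E.
Proof.
move=> a1 t0; have a0 : (0 < a)%R by lra.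
case: y => [y| |]//; last by rewrite poweRyr ?gt_eqF// addye ?leey.
rewrite lee_fin => y0; rewrite poweR_EFin -!EFinM -EFinD lee_fin.
have [->|tn0] := eqVneq t 0%R.
  rewrite powR0 ?subr_eq0 ?gt_eqF// powR0 ?gt_eqF// mul0r !mulr0 addr0.
  exact: powR_ge0.
have tp : (0 < t)%R by rewrite lt_neqAle eq_sym tn0.
have ytE : ((y / t) `^ a * t `^ a = y `^ a)%R.
  by rewrite -powRM ?divr_ge0// divfK.
have /(ler_wpM2r (powR_ge0 t a)) := powR_ge_tangent a1 (divr_ge0 y0 t0).
rewrite mulrDl ytE.
rewrite (_ : a * (y / t) * t `^ a = a * (t `^ (a - 1) * y))%R//.
rewrite -!mulrA; congr (_ * _)%R; rewrite mulrC; congr (_ * _)%R.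
rewrite -{1}(powRr1 t0) -powRN -powRD; last by rewrite tn0 implybT.
by congr (_ `^ _)%R; ring.
Qed.

Lemma maxe_mul0r z x : 0 <= z -> maxe (z * x) 0 = z * maxe x 0.
Proof.
move=> z0; have [x0|/ltW x0] := leP x 0.
  by rewrite mule0 max_r// mule_ge0_le0.
by rewrite max_l// mule_ge0.
Qed.

(** The entropy weight log f may change sign, but for radially decreasing f its two parts are
    nonnegative and radially monotone in opposite senses, so each is an admissible test function. *)
Definition lnep x := maxe (lne x) 0.
Definition lnen x := maxe (- lne x) 0.

Lemma lnep_ge0 x : 0 <= lnep x. Proof. by rewrite le_max lexx orbT. Qed.
Lemma lnen_ge0 x : 0 <= lnen x. Proof. by rewrite le_max lexx orbT. Qed.

Lemma maxr_subN a : (Num.max a 0 - Num.max (- a) 0 = a)%R.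
Proof. by case: (leP a 0%R) => a0; case: (leP (- a)%R 0%R) => a0'; lra. Qed.

Let ge0_addye x : 0 <= x -> +oo + x = +oo.
Proof. by move=> x0; rewrite addye// gt_eqF// (lt_le_trans (ltNyr 0)). Qed.

(* [y log x + y <= y log y + x], with each logarithm split into its positive and
   negative parts so that no infinite terms are subtracted. *)
Lemma lne_tangent_split x y : 0 <= x -> 0 <= y ->
  maxe (- (y * lne y)) 0 + y * lnep x + y <=
  maxe (y * lne y) 0 + x + y * lnen x.
Proof.
move=> x0 y0; have max0 (z : \bar R) : 0 <= maxe z 0 by rewrite le_max lexx orbT.
have yn0 : 0 <= y * lnen x by rewrite mule_ge0// lnen_ge0.
case: y y0 yn0 => [y| |]// y0 yn0; last first.
  rewrite [leRHS](_ : _ = +oo) ?leey//.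
  by rewrite [lne _]/= [+oo * +oo]gt0_mulye// maxye -addeA ge0_addye// adde_ge0.
move: y0; rewrite le_eqVlt => /predU1P[[y0]|y0].
  by rewrite -y0 !mul0e oppe0 maxxx !adde0 add0e.
have addy z : z = +oo -> maxe (y%:E * lne y%:E) 0 + x + z = +oo.
  by move=> ->; rewrite addeC ge0_addye// adde_ge0.
have [x_eq0|xn0] := eqVneq x 0.
  by rewrite addy ?leey// /lnen x_eq0/= lexx/= maxye gt0_muley.
case: x x0 xn0 yn0 addy => [x| |]// x0 xn0 yn0 _; last first.
  by rewrite [X in _ <= X + _]addeC ge0_addye// ge0_addye// leey.
have xp : (0 < x)%R by rewrite lt_neqAle eq_sym -eqe xn0 -lee_fin.
rewrite lte_fin in y0; rewrite /lnep /lnen !lne_EFin// -?EFinM -?EFinN -!EFin_max.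
rewrite -?EFinM -?EFinD lee_fin.
have := ln_ge_tangent y0 xp.
have := maxr_subN (y * ln y); have := congr1 ( *%R y) (maxr_subN (ln x)).
rewrite mulrBr; lra.
Qed.

(** A one-sided consequence of the tangent inequality, dropping the favourable terms. It makes the
    negative part of g log g integrable once g times the negative part of log f is. *)
Lemma lne_tangent_neg x y : 0 <= x -> 0 <= y ->
  maxe (- (y * lne y)) 0 <= y * lnen x + x.
Proof.
move=> x0 y0; have yn0 : 0 <= y * lnen x by rewrite mule_ge0// lnen_ge0.
case: y y0 yn0 => [y| |]// y0 yn0; last first.
  by rewrite gt0_mulye//= maxNye adde_ge0.
move: y0; rewrite le_eqVlt => /predU1P[[y0]|y0].
  by rewrite -y0 !mul0e oppe0 maxxx add0e.
have [x_eq0|xn0] := eqVneq x 0.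
  by rewrite {1}/lnen x_eq0/= lexx/= maxye gt0_muley// ge0_addye// leey.
case: x x0 xn0 yn0 => [x| |]// x0 xn0 yn0; last first.
  by rewrite addeC ge0_addye// leey.
have xp : (0 < x)%R by rewrite lt_neqAle eq_sym -eqe xn0 -lee_fin.
rewrite lte_fin in y0; rewrite /lnen !lne_EFin// -?EFinM -?EFinN -!EFin_max.
rewrite -?EFinM -?EFinD lee_fin.
have := ln_ge_tangent y0 xp.
have : (0 <= Num.max (- ln x) 0)%R by rewrite le_max lexx orbT.
have : (y * - ln x <= y * Num.max (- ln x) 0)%R.
  by rewrite ler_pM2l// le_max lexx.
rewrite mulrN => h1 h2 h3.
by rewrite ge_max; apply/andP; split; [lra|rewrite addr_ge0// ?mulr_ge0// ltW].
Qed.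

End pointwise_inequalities.

(** * Comparison of power integrals and entropies *)

Section entropy_comparison.
Context (R : realType) (d : nat).
Local Notation mu := (@lebesgue_rV R d).
Variables f g : 'rV[R]_d -> \bar R.
Hypotheses (mf : measurable_fun setT f) (f0 : forall x, 0 <= f x).
Hypotheses (mg : measurable_fun setT g) (g0 : forall x, 0 <= g x).
Hypotheses (f1 : \int[mu]_x f x = 1) (g1 : \int[mu]_x g x = 1).
Hypothesis df : radially_decreasing f.
Hypothesis le_dec : forall h, measurable_fun setT h -> (forall x, 0 <= h x) ->
  radially_decreasing h -> \int[mu]_x (h x * f x) <= \int[mu]_x (h x * g x).
Hypothesis le_inc : forall h, measurable_fun setT h -> (forall x, 0 <= h x) ->
  radially_increasing h -> \int[mu]_x (h x * g x) <= \int[mu]_x (h x * f x).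

Let m_poweR (k : 'rV[R]_d -> \bar R) a : measurable_fun setT k ->
  measurable_fun setT (fun x => k x `^ a).
Proof. exact: (measurableT_comp (measurable_poweR a)). Qed.

Let poweR_homo a : (0 <= a)%R -> {in [pred x : \bar R | 0 <= x] &,
  {homo (fun x => poweR x a) : x y / x <= y}}.
Proof.
by move=> a0 x y x0 y0 xy; apply: gt0_ler_poweR => //; rewrite in_itv/= leey andbT.
Qed.

(** The slope h = f^(a-1) is radially increasing, so the integral of h g is at most that of h f. The
    coefficients a and 1 - a then add up to 1, so no finiteness is required. *)
Lemma integral_poweR_lt1 a : (0 < a < 1)%R ->
  \int[mu]_x (g x `^ a) <= \int[mu]_x (f x `^ a).
Proof.
move=> a01; have /andP[a0 a1] := a01; have a'0 : (0 <= 1 - a)%R by lra.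
pose h x := (f x `^ (1 - a))^-1.
have h0 x : 0 <= h x by rewrite inve_ge0 poweR_ge0.
have ih : radially_increasing h.
  by move=> x y xy; rewrite lee_pV2 ?inE ?poweR_ge0//; apply: poweR_homo; rewrite ?inE// df.
have mh := measurable_radially_increasing ih.
(* Only an inequality: where f = +oo the product is 0 while f^a is infinite. *)
have hf_le x : h x * f x <= f x `^ a.
  rewrite /h; have := f0 x; case: (f x) => [r| |]// r0; last first.
    by rewrite poweRyr ?invey ?mul0e ?poweR_ge0//; lra.
  have [->|rn0] := eqVneq r 0%R; first by rewrite mule0 poweR_ge0.
  have rp : (0 < r)%R by rewrite lt_neqAle eq_sym rn0 -lee_fin.
  rewrite poweR_EFin inver gt_eqF ?powR_gt0// -EFinM lee_fin.
  rewrite -powRN -{2}(powRr1 (ltW rp)) -powRD ?rn0 ?implybT//.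
  by rewrite (_ : (- (1 - a) + 1 = a)%R)//; ring.
apply: (@le_trans _ _ (\int[mu]_x (a%:E * (h x * g x) + (1 - a)%:E * f x `^ a))).
  apply: ge0_le_integral => //.
  - by move=> x _; exact: poweR_ge0.
  - exact: m_poweR.
  - apply: emeasurable_funD; apply: emeasurable_funM => //.
      exact: emeasurable_funM.
    exact: m_poweR.
  - by move=> x _; exact: poweR_le_tangent.
have hg0 x : 0 <= h x * g x by rewrite mule_ge0.
have fa0 x : 0 <= f x `^ a by exact: poweR_ge0.
have mhg : measurable_fun setT (fun x => h x * g x) by exact: emeasurable_funM.
have mfa : measurable_fun setT (fun x => f x `^ a) by exact: m_poweR.
have a0E : 0 <= a%:E by rewrite lee_fin ltW.
have a'0E : 0 <= (1 - a)%:E by rewrite lee_fin.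
rewrite ge0_integralD//; first last.
- exact: emeasurable_funM.
- by move=> x _; rewrite mule_ge0.
- exact: emeasurable_funM.
- by move=> x _; rewrite mule_ge0.
rewrite !ge0_integralZl//.
rewrite [leRHS](_ : _ = a%:E * \int[mu]_x (f x `^ a) +
    (1 - a)%:E * \int[mu]_x (f x `^ a)); last first.
  by rewrite -ge0_muleDl// -EFinD addrC subrK mul1e.
rewrite leeD2r// lee_wpmul2l//.
apply: (le_trans (le_inc mh h0 ih)); apply: ge0_le_integral => //.
- by move=> x _; rewrite mule_ge0.
- exact: emeasurable_funM.
Qed.

(** The integral of f^a occurs on both sides of the integrated tangent inequality and may be
    infinite. The argument is therefore run at the truncation min(f, n), still radially decreasing,
    and the bound passes to the limit over the sets where f <= n. *)
Lemma integral_poweR_gt1 a : (1 < a)%R ->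
  \int[mu]_x (f x `^ a) <= \int[mu]_x (g x `^ a).
Proof.
move=> a1; have a0 : (0 < a)%R by lra.
have trunc (n : nat) : \int[mu]_(x in [set x | f x <= n%:R%:E]) (f x `^ a) <=
    \int[mu]_x (g x `^ a).
  pose u x := fine (mine (f x) n%:R%:E).
  have uE x : (u x)%:E = mine (f x) n%:R%:E.
    rewrite fineK// ge0_fin_numE ?le_min ?f0/= ?lee_fin//.
    by rewrite gt_min ltry orbT.
  have u0 x : (0 <= u x)%R by rewrite -lee_fin uE le_min f0/= lee_fin.
  have un x : (u x <= n%:R)%R by rewrite -lee_fin uE ge_min lexx orbT.
  have uf x : (u x)%:E <= f x by rewrite uE ge_min lexx.
  have du x y : (enorm x <= enorm y)%R -> (u y <= u x)%R.
    move=> xy; rewrite -lee_fin !uE le_min !ge_min lexx orbT andbT.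
    by rewrite (df xy).
  have dpow b : (0 <= b)%R -> radially_decreasing (fun x => (u x `^ b)%:E).
    move=> b0 x y xy; rewrite lee_fin.
    by rewrite ge0_ler_powR ?nnegrE// du.
  have a10 : (0 <= a - 1)%R by lra.
  have mpow b : (0 <= b)%R -> measurable_fun setT (fun x => (u x `^ b)%:E).
    by move=> b0; apply: measurable_radially_decreasing; exact: dpow.
  have pow0 b x : 0 <= (u x `^ b)%:E by rewrite lee_fin powR_ge0.
  have uaE x : (u x `^ a = u x `^ (a - 1) * u x)%R.
    rewrite -[X in (_ * X)%R]powRr1// -powRD ?subrK//; apply/implyP.
    by rewrite gt_eqF.
  pose A := \int[mu]_x (u x `^ a)%:E.
  have A0 : 0 <= A by apply: integral_ge0.
  (* From u^a <= n^(a-1) f and the unit mass of [f]. *)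
  have Afin : A < +oo.
    apply: (@le_lt_trans _ _ (\int[mu]_x ((n%:R `^ (a - 1))%:E * f x))).
      apply: ge0_le_integral => //; first by apply: mpow; lra.
        exact: emeasurable_funM.
      move=> x _; rewrite uaE EFinM; apply: lee_pmul => //; first by rewrite lee_fin.
      by rewrite lee_fin ge0_ler_powR// nnegrE.
    by rewrite ge0_integralZl// ?lee_fin ?powR_ge0// f1 mule1 ltry.
  pose B := \int[mu]_x (g x `^ a).
  have B0 : 0 <= B by apply: integral_ge0 => x _; exact: poweR_ge0.
  (* The chain is a∫u^a <= a∫u^(a-1) f <= a∫u^(a-1) g <= ∫g^a + (a-1)∫u^a, by u <= f, radial
     comparison and tangency at [u]. *)
  have AB : a%:E * A <= B + (a - 1)%:E * A.
    apply: (@le_trans _ _ (\int[mu]_x (a%:E * ((u x `^ (a - 1))%:E * g x)))).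
      rewrite ge0_integralZl//; first last.
      - by rewrite lee_fin ltW.
      - by move=> x _; rewrite mule_ge0.
      - by apply: emeasurable_funM => //; exact: mpow.
      rewrite lee_wpmul2l ?lee_fin ?(ltW a0)//.
      apply: le_trans (le_dec (mpow _ a10) (pow0 _) (dpow _ a10)).
      apply: ge0_le_integral => //; first by apply: mpow; lra.
        by apply: emeasurable_funM => //; exact: mpow.
      by move=> x _; rewrite uaE EFinM lee_wpmul2l.
    apply: (@le_trans _ _ (\int[mu]_x (g x `^ a + (a - 1)%:E * (u x `^ a)%:E))).
      apply: ge0_le_integral => //.
      - by move=> x _; rewrite !mule_ge0// lee_fin ltW.
      - by do 2 apply: emeasurable_funM => //; exact: mpow.
      - apply: emeasurable_funD; first exact: m_poweR.
        by apply: emeasurable_funM => //; apply: mpow; lra.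
      - by move=> x _; rewrite -EFinM; exact: poweR_ge_tangent.
    have ma : measurable_fun setT (fun x => (u x `^ a)%:E) by apply: mpow; lra.
    rewrite ge0_integralD//; first last.
    - exact: emeasurable_funM.
    - by move=> x _; rewrite mule_ge0.
    - exact: m_poweR.
    - by move=> x _; exact: poweR_ge0.
    by rewrite ge0_integralZl.
  have {AB}AB : A <= B.
    have Af : A \is a fin_num by rewrite ge0_fin_numE.
    move: AB B0; case: B => [b| |] AB B0; [|by rewrite leey|by []].
    by move: AB; rewrite -(fineK Af) -!EFinM -EFinD !lee_fin => ?; lra.
  apply: le_trans AB; rewrite integral_mkcond.
  apply: ge0_le_integral => //.
  - by move=> x _; rewrite patchE; case: ifP => // _; exact: poweR_ge0.
  - have mDn : measurable [set x | f x <= n%:R%:E].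
      by rewrite -[X in measurable X]setTI; exact: emeasurable_fun_infty_c.
    apply/(measurable_restrictT _ mDn); apply: measurable_funTS; exact: m_poweR.
  - by apply: mpow; lra.
  - move=> x _; rewrite patchE; case: ifPn => // /set_mem/= fxn.
    by rewrite -poweR_EFin uE min_l.
pose D (n : nat) := [set x | f x <= n%:R%:E].
have mD n : measurable (D n).
  by rewrite -[X in measurable X]setTI; exact: emeasurable_fun_infty_c.
(* The density [f] is integrable, hence finite almost everywhere, so the sets [D n] exhaust the
   space up to a null set. *)
have -> : \int[mu]_x (f x `^ a) = \int[mu]_(x in \bigcup_n D n) (f x `^ a).
  have mU : measurable (\bigcup_n D n) by exact: bigcup_measurable.
  rewrite [RHS]integral_mkcond; apply: ge0_ae_eq_integral => //.
  - exact: m_poweR.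
  - apply/(measurable_restrictT _ mU); apply: measurable_funTS; exact: m_poweR.
  - by move=> x _; exact: poweR_ge0.
  - by move=> x _; rewrite patchE; case: ifP => // _; exact: poweR_ge0.
  have intf : mu.-integrable setT f.
    apply/integrableP; split => //; under eq_integral do rewrite gee0_abs//.
    by rewrite f1 ltry.
  apply: filterS (integrable_ae measurableT intf) => x /= /(_ I) fx _.
  rewrite patchE ifT// inE; exists (Num.truncn (fine (f x))).+1 => //=.
  by rewrite /D/= -[leLHS]fineK// lee_fin ltW// truncnS_gt.
have cv := @ge0_nondecreasing_set_cvg_integral _ _ _ D (fun x => f x `^ a) mu.
have {}cv : \int[mu]_(x in D n) (f x `^ a) @[n --> \oo] -->
    \int[mu]_(x in \bigcup_n D n) (f x `^ a).
  apply: cv => //.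
  - move=> n m nm; apply/subsetPset => x /= /le_trans; apply.
    by rewrite lee_fin ler_nat.
  - by move=> n; apply: measurable_funTS; exact: m_poweR.
  - by move=> n x _; exact: poweR_ge0.
rewrite -(cvg_lim _ cv)//; apply: lime_le; first by apply/cvg_ex; eexists; exact: cv.
by near=> n; exact: trunc.
Unshelve. all: by end_near.
Qed.

(** The split tangent inequality is integrated at x := f, y := g; the linear terms contribute both
    masses, equal to 1. Radial comparison then replaces g by f as the weight against each part of
    log f. *)
Lemma integral_lne_le :
  \int[mu]_x (f x * lne (f x)) <= \int[mu]_x (g x * lne (g x)).
Proof.
have dlne : radially_decreasing (fun x => lnep (f x)).
  move=> x y xy; rewrite /lnep ge_max !le_max lexx orbT andbT.
  by rewrite lee_lne ?in_itv/= ?leey ?f0// df.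
have ilne : radially_increasing (fun x => lnen (f x)).
  move=> x y xy; rewrite /lnen ge_max !le_max lexx orbT andbT leeN2.
  by rewrite lee_lne ?in_itv/= ?leey ?f0// df.
have mp := measurable_radially_decreasing dlne.
have mn := measurable_radially_increasing ilne.
have p0 x : 0 <= lnep (f x) by exact: lnep_ge0.
have n0 x : 0 <= lnen (f x) by exact: lnen_ge0.
have mxlnx (k : 'rV[R]_d -> \bar R) : measurable_fun setT k ->
    measurable_fun setT (fun x : 'rV[R]_d => k x * lne (k x)).
  by move=> mk; exact: (emeasurable_funM mk (measurableT_comp (measurable_lne (R := R)) mk)).
have max0 (z : \bar R) : 0 <= maxe z 0 by rewrite le_max lexx orbT.
rewrite [leLHS]integralE [leRHS]integralE.
rewrite [X in X - _ <= _](_ : _ = \int[mu]_x (lnep (f x) * f x)); last first.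
  apply: eq_integral => x _; rewrite funeposE /lnep [RHS]muleC.
  exact: maxe_mul0r.
rewrite [X in _ - X <= _](_ : _ = \int[mu]_x (lnen (f x) * f x)); last first.
  apply: eq_integral => x _; rewrite funenegE /lnen [RHS]muleC.
  by rewrite -muleN; exact: maxe_mul0r.
(* [a] and [b] are the integrals of the positive and negative parts of g log g. [p] and [q]
   integrate the two parts of log f against f, and [p'] and [q'] do so against g. *)
set a := (X in _ <= X - _); set b := (X in _ <= _ - X).
set p := \int[mu]_x (lnep (f x) * f x); set q := \int[mu]_x (lnen (f x) * f x).
set p' := \int[mu]_x (lnep (f x) * g x); set q' := \int[mu]_x (lnen (f x) * g x).
have mpg : measurable_fun setT (fun x => lnep (f x) * g x) by exact: emeasurable_funM.
have mng : measurable_fun setT (fun x => lnen (f x) * g x) by exact: emeasurable_funM.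
have mga := measurable_funepos (mxlnx g mg); have mgb := measurable_funeneg (mxlnx g mg).
have pg0 x : 0 <= lnep (f x) * g x by rewrite mule_ge0.
have ng0 x : 0 <= lnen (f x) * g x by rewrite mule_ge0.
have a0 : 0 <= a by apply: integral_ge0 => x _; exact: funepos_ge0.
have b0 : 0 <= b by apply: integral_ge0 => x _; exact: funeneg_ge0.
have p0' : 0 <= p by apply: integral_ge0 => x _; rewrite mule_ge0.
have q0 : 0 <= q by apply: integral_ge0 => x _; rewrite mule_ge0.
have p'0 : 0 <= p' by exact: integral_ge0.
have q'0 : 0 <= q' by exact: integral_ge0.
have bq : b <= q' + 1.
  rewrite -f1 -ge0_integralD//; apply: ge0_le_integral => //.
    exact: emeasurable_funD.
  by move=> x _; rewrite funenegE [lnen _ * _]muleC; exact: lne_tangent_neg.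
have bpaq : b + p' + 1 <= a + 1 + q'.
  rewrite -{1}g1 -f1 -!ge0_integralD//; first last.
  - exact: emeasurable_funD.
  - by move=> x _; rewrite adde_ge0.
  - exact: emeasurable_funD.
  - by move=> x _; rewrite adde_ge0.
  apply: ge0_le_integral => //.
  - by move=> x _; rewrite !adde_ge0.
  - by do 2 apply: emeasurable_funD => //.
  - by do 2 apply: emeasurable_funD => //.
  move=> x _; rewrite funeposE funenegE ![_ (f x) * g x]muleC.
  exact: lne_tangent_split.
have qq' : q' <= q := le_inc mn n0 ilne.
have pp' : p <= p' := le_dec mp p0 dlne.
clearbody a b p q p' q'.
(* If q = +oo, the left side is -oo by convention. Otherwise q' <= q and b <= q' + 1 are finite;
   then either a = +oo, which is trivial, or [bpaq] makes p', hence p, finite, and the claim is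
   linear arithmetic. *)
case: q qq' q0 => [q| |]// qq' q0; last by rewrite addeNy leNye.
case: q' qq' q'0 bq bpaq => [q'| |]// qq' q'0 bq bpaq.
case: b b0 bq bpaq => [b| |]// b0 bq bpaq.
case: a a0 bpaq => [a| |]// a0 bpaq; last by rewrite addye// leey.
case: p' p'0 pp' bpaq => [p'| |]// p'0 pp' bpaq.
case: p p0' pp' => [p| |]// p0' pp'.
by move: qq' pp' bpaq; rewrite -!EFinB -!EFinD !lee_fin; lra.
Qed.

(** The power integrals compare in opposite directions on the two sides of 1, and the sign of 1 / (1
    - a) compensates. *)
Lemma le_renyi_entropy a : (0 < a)%R -> renyi_entropy a g <= renyi_entropy a f.
Proof.
move=> a0; rewrite /renyi_entropy; case: eqVneq => [_|an1].
  by rewrite leeN2 integral_lne_le.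
have i0 k : 0 <= \int[mu]_x (k x `^ a) by apply: integral_ge0 => x _; exact: poweR_ge0.
have lne_homo k k' : \int[mu]_x (k x `^ a) <= \int[mu]_x (k' x `^ a) ->
    lne (\int[mu]_x (k x `^ a)) <= lne (\int[mu]_x (k' x `^ a)).
  by rewrite lee_lne ?in_itv/= ?leey ?i0.
have [a1|a1|/eqP] := ltgtP a 1%R; last by rewrite (negbTE an1).
  apply: lee_wpmul2l; first by rewrite lee_fin invr_ge0 subr_ge0 ltW.
  by apply: (lne_homo g f); apply: integral_poweR_lt1; rewrite a0.
rewrite -leeN2 -!mulNe -EFinN; apply: lee_wpmul2l.
  by rewrite lee_fin oppr_ge0 invr_le0 subr_le0 ltW.
by apply: (lne_homo f g); exact: integral_poweR_gt1.
Qed.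

End entropy_comparison.

(** * Rearrangements *)

Section ball_volume.
Context (R : realType) (d : nat).
Local Notation mu := (@lebesgue_rV R d).

(* The [if] is only needed in dimension 0, where [x `^ 0 = 1] even for [x = 0]. *)
Definition volume_radius (v : R) : R :=
  if v == 0%R then 0%R else ((v / fine (mu (eball 1))) `^ (d%:R^-1))%R.

Let c := fine (mu (eball 1%R)).

Let cE : mu (eball 1%R) = c%:E.
Proof. by rewrite fineK// ge0_fin_numE// lebesgue_rV_eball_fin. Qed.

Let c_gt0 : (0 < c)%R.
Proof. by rewrite fine_gt0// lebesgue_rV_eball_gt0// lebesgue_rV_eball_fin. Qed.

Lemma eball0 : @eball R d 0%R = set0.
Proof. by apply/seteqP; split => // x; rewrite /eball/= ltNge enorm_ge0. Qed.

Lemma volume_radius_ge0 v : (0 <= volume_radius v)%R.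
Proof. by rewrite /volume_radius; case: ifP => // _; exact: powR_ge0. Qed.

Lemma le_volume_radius v v' : (0 <= v)%R -> (v <= v')%R ->
  (volume_radius v <= volume_radius v')%R.
Proof.
move=> v0 vv'; rewrite {1}/volume_radius; case: ifPn => [_|vn0].
  exact: volume_radius_ge0.
have vp : (0 < v)%R by rewrite lt_neqAle eq_sym vn0.
rewrite /volume_radius gt_eqF ?(lt_le_trans vp)//.
have v'0 := le_trans v0 vv'.
by rewrite ge0_ler_powR ?invr_ge0// ?nnegrE ?divr_ge0 ?(ltW c_gt0)// ler_pM2r ?invr_gt0.
Qed.

Lemma lebesgue_rV_volume_radius A : measurable A -> mu A < +oo ->
  mu (eball (volume_radius (fine (mu A)))) = mu A.
Proof.
move=> mA Afin; have AE : mu A = (fine (mu A))%:E by rewrite fineK// ge0_fin_numE.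
have := fine_ge0 (measure_ge0 mu A); move: AE; set v := fine (mu A) => AE v0.
rewrite AE /volume_radius; case: ifPn => [/eqP ->|vn0].
  by rewrite eball0 measure0.
have vp : (0 < v)%R by rewrite lt_neqAle eq_sym vn0.
have rp : (0 < (v / c) `^ (d%:R^-1))%R by rewrite powR_gt0// divr_gt0.
rewrite lebesgue_rV_eball// cE -EFinM; congr (_%:E).
have [d0|dn0] := eqVneq d 0%N; last first.
  rewrite -powR_mulrn ?powR_ge0// -powRrM mulVf ?pnatr_eq0// powRr1.
    by rewrite divfK// gt_eqF.
  by rewrite divr_ge0// ltW.
(* In dimension 0 the exponent 0^-1 is 0, so the radius is 1; a set of nonzero measure is the whole
   one-point space, which is also the unit ball. *)
suff : mu A = c%:E by rewrite AE => -[->]; rewrite divff ?gt_eqF// powR1 expr1n mul1r.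
rewrite -cE; congr (lebesgue_rV _).
have x0 (x : 'rV[R]_d) : x = 0%R.
  by apply/rowP => -[i]; move: x; rewrite d0.
have -> : eball 1%R = [set: 'rV[R]_d].
  by apply/seteqP; split => // x _; rewrite /eball/= (x0 x) enorm0.
have [x Ax] : A !=set0.
  apply/set0P; apply: contraNneq vn0 => A0.
  by rewrite -eqe -AE A0 measure0.
by apply/seteqP; split => // y _; have -> : y = x by rewrite (x0 x) (x0 y).
Qed.

(** The smaller radius is the norm of a point: in dimension 0 all balls of positive radius have
    equal volume, but there every norm is 0 and the smaller ball is empty. *)
Lemma lt_lebesgue_rV_eball (x : 'rV[R]_d) r : (enorm x < r)%R ->
  mu (eball (enorm x)) < mu (eball r).
Proof.
move=> xr; have r0 := le_lt_trans (enorm_ge0 x) xr.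
have [x0|xn0] := eqVneq x 0%R.
  by rewrite x0 enorm0 eball0 measure0 lebesgue_rV_eball_gt0.
have xp : (0 < enorm x)%R by rewrite lt_neqAle eq_sym enorm_eq0 xn0 enorm_ge0.
have dn0 : d != 0%N.
  apply: contra_neq xn0 => d0; apply/rowP => -[i].
  by move: (x); rewrite d0.
rewrite (lebesgue_rV_eball d xp) (lebesgue_rV_eball d r0) cE -!EFinM lte_fin ltr_pM2r//.
by rewrite ltrXn2r ?dn0// ltW.
Qed.

End ball_volume.

(** * Existence of rearrangements and comparison on balls *)

Section rearrangement.
Context (R : realType) (d : nat).
Local Notation mu := (@lebesgue_rV R d).
Implicit Types f g fs : 'rV[R]_d -> \bar R.

Lemma measurable_gt f (t : R) : measurable_fun setT f ->
  measurable [set x | t%:E < f x].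
Proof. by move=> mf; rewrite -[X in measurable X]setTI; exact: emeasurable_fun_o_infty. Qed.

Lemma superlevel_fin f (t : R) : measurable_fun setT f -> (forall x, 0 <= f x) ->
  \int[mu]_x f x < +oo -> (0 < t)%R -> mu [set x | t%:E < f x] < +oo.
Proof.
move=> mf f0 foo t0; have mA := measurable_gt t mf.
have : t%:E * mu [set x | t%:E < f x] <= \int[mu]_x f x.
  rewrite -integral_cst//; apply: (@le_trans _ _ (\int[mu]_(x in [set x | t%:E < f x]) f x)).
    apply: ge0_le_integral => //.
    - by move=> x _; rewrite lee_fin ltW.
    - exact: measurable_funTS.
    - by move=> x /ltW.
  exact: ge0_subset_integral.
move=> /le_lt_trans /(_ foo); case: (mu _) => [r| |]; rewrite ?ltry//.
by rewrite gt0_muley.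
Qed.

(** With [rho t] the radius of a ball as large as {f > t}, the value of [fs] at x is the supremum of
    the levels t > 0 with |x| < rho t. Its superlevel volumes are right because the distribution
    function of [f] is right-continuous. *)
Lemma rearrangement_exists f : measurable_fun setT f -> (forall x, 0 <= f x) ->
  \int[mu]_x f x < +oo -> exists2 fs, measurable_fun setT fs & is_rearrangement f fs.
Proof.
move=> mf f0 foo.
pose m t := mu [set x | t%:E < f x].
have mfin t : (0 < t)%R -> m t < +oo by exact: superlevel_fin.
have m_anti s t : (s <= t)%R -> m t <= m s.
  move=> st; apply: le_measure; rewrite ?inE; [exact: measurable_gt..|].
  by move=> x /=; apply: le_lt_trans; rewrite lee_fin.
pose rho t := volume_radius d (fine (m t)).
have rhoE t : (0 < t)%R -> mu (eball (rho t)) = m t.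
  by move=> t0; rewrite lebesgue_rV_volume_radius ?mfin//; exact: measurable_gt.
have rho_anti s t : (0 < s)%R -> (s <= t)%R -> (rho t <= rho s)%R.
  move=> s0 st; apply: le_volume_radius; first by rewrite fine_ge0// measure_ge0.
  by rewrite fine_le ?m_anti// ge0_fin_numE ?measure_ge0// mfin// (lt_le_trans s0).
have rho0 t : (0 <= rho t)%R by exact: volume_radius_ge0.
pose S (x : 'rV[R]_d) := [set t%:E | t in [set t : R | (0 < t)%R /\ (enorm x < rho t)%R]].
(* The maximum with 0 covers points where [S x] is empty and the supremum is -oo. *)
pose fs (x : 'rV[R]_d) := maxe 0 (ereal_sup (S x)).
have fs_gt x t : (0 < t)%R -> (t%:E < fs x <-> exists2 s, (t < s)%R & (enorm x < rho s)%R).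
  move=> t0; have tn0 : (t%:E < 0) = false by rewrite lte_fin ltNge (ltW t0).
  rewrite /fs lt_max tn0/=; split.
    by move=> /ereal_sup_gt[_ [s [s0 xs] <-]]; rewrite lte_fin => ts; exists s.
  move=> [s ts xs]; apply: (@lt_le_trans _ _ s%:E); first by rewrite lte_fin.
  by apply: ereal_sup_ubound; exists s => //; split => //; exact: lt_trans ts.
exists fs.
  apply: measurable_radially_decreasing => x y xy.
  rewrite /fs ge_max !le_max lexx/=; apply/orP; right; apply: ereal_sup_le => _ [t [t0 yt] <-].
  by exists t => //; split => //; exact: le_lt_trans yt.
split=> [x|t t0]; first by rewrite /fs le_max lexx.
(* The set {fs > t} is the union of the open balls of radius [rho s] over s > t, hence the ball
   whose radius is the supremum. *)
pose r := sup [set rho s | s in [set s | (t < s)%R]].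
have hs : has_sup [set rho s | s in [set s | (t < s)%R]].
  split; first by exists (rho (t + 1)%R); exists (t + 1)%R => //=; lra.
  by exists (rho t) => _ [s /= ts <-]; apply: rho_anti => //; exact: ltW.
have fsE : [set x | t%:E < fs x] = eball r.
  apply/seteqP; split => x /=.
    move=> /(fs_gt _ _ t0)[s ts xs]; apply: (lt_le_trans xs).
    by apply: ub_le_sup; [case: hs|exists s].
  rewrite /eball/= => xr; apply/(fs_gt _ _ t0).
  by have [_ [s ts <-] xs] := sup_gt (proj1 hs) xr; exists s.
exists r.
  apply: (@le_trans _ _ (rho (t + 1)%R)) => //.
  by apply: ub_le_sup; [case: hs|exists (t + 1)%R => //=; lra].
split => //.
(* Along levels decreasing to [t], both superlevel sets are increasing unions whose stages have
   equal volume; continuity from below concludes. *)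
pose tn (n : nat) : R := (t + n.+1%:R^-1)%R.
have tn0 n : (0 < tn n)%R by rewrite addr_gt0.
have ttn n : (t < tn n)%R by rewrite ltrDl.
have tn_anti i j : (i <= j)%N -> (tn j <= tn i)%R.
  by move=> ij; rewrite lerD2l lef_pV2 ?posrE// ler_nat.
have tn_lt (s : R) : (t < s)%R -> exists n, (tn n <= s)%R.
  move=> ts; have st0 : (0 < (s - t)^-1)%R by rewrite invr_gt0 subr_gt0.
  exists (Num.truncn (s - t)^-1); rewrite /tn -lerBrDl.
  by rewrite invf_ple ?posrE ?subr_gt0// ltW// truncnS_gt.
have cvg1 : mu (eball (rho (tn n))) @[n --> \oo] -->
    mu (\bigcup_n (eball (rho (tn n)) : set 'rV[R]_d)).
  apply: nondecreasing_cvg_mu.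
  - by move=> n; exact: measurable_eball.
  - by apply: bigcup_measurable => n _; exact: measurable_eball.
  - move=> i j ij; apply/subsetPset => x /=; rewrite /eball/= => /lt_le_trans; apply.
    by apply: rho_anti => //; exact: tn_anti.
have cvg2 : m (tn n) @[n --> \oo] --> mu (\bigcup_n [set x | (tn n)%:E < f x]).
  apply: nondecreasing_cvg_mu.
  - by move=> n; exact: measurable_gt.
  - by apply: bigcup_measurable => n _; exact: measurable_gt.
  - move=> i j ij; apply/subsetPset => x /=; apply: le_lt_trans.
    by rewrite lee_fin tn_anti.
have -> : [set x | t%:E < fs x] = \bigcup_n eball (rho (tn n)).
  apply/seteqP; split => x /=.
    move=> /(fs_gt _ _ t0)[s ts xs]; have [n ns] := tn_lt s ts.
    by exists n => //; rewrite /eball/=; apply: lt_le_trans xs _; exact: rho_anti.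
  by move=> [n _ xn]; apply/(fs_gt _ _ t0); exists (tn n).
have -> : [set x | t%:E < f x] = \bigcup_n [set x | (tn n)%:E < f x].
  apply/seteqP; split => x /=; last first.
    by move=> [n _ /=]; apply: lt_trans; rewrite lte_fin.
  move=> tx; suff [s ts sx] : exists2 s : R, (t < s)%R & s%:E < f x.
    have [n ns] := tn_lt s ts.
    by exists n => //=; apply: le_lt_trans sx; rewrite lee_fin.
  move: tx (f0 x); case: (f x) => [y| |]// => [|_ _].
    by rewrite lte_fin => ty _; exists ((t + y) / 2)%R; rewrite ?lte_fin; lra.
  by exists (t + 1)%R; [lra|rewrite ltry].
have rhotn : (fun n => mu (eball (rho (tn n)))) = (fun n => m (tn n)).
  by apply/funext => n; rewrite rhoE.
by apply: (cvg_unique _ cvg1); rewrite ?rhotn.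
Qed.

(** If f x <= t < fs x, then {f > t} lies in the ball of radius |x|, whereas {fs > t} is a ball
    containing x and so has strictly larger volume. *)
Lemma rearrangement_le_radial f fs : measurable_fun setT f -> (forall x, 0 <= f x) ->
  radially_decreasing f -> is_rearrangement f fs -> forall x, fs x <= f x.
Proof.
move=> mf f0 df [fs0 fsE] x; rewrite leNgt; apply/negP => fx.
have [t [t0 ft tfs]] : exists t : R, [/\ (0 < t)%R, f x <= t%:E & t%:E < fs x].
  move: fx (f0 x); case: (f x) => [a| |]//; case: (fs x) => [b| |]//.
  - rewrite lte_fin !lee_fin => ab a0; exists ((a + b) / 2)%R.
    by rewrite lee_fin lte_fin; split; lra.
  - by move=> _; rewrite lee_fin => a0; exists (a + 1)%R; rewrite lee_fin ltry; split => //; lra.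
have [r r0 [fsr mur]] := fsE t t0.
have xr : (enorm x < r)%R.
  by have : [set x | t%:E < fs x] x by []; rewrite fsr.
have := lt_lebesgue_rV_eball xr; rewrite ltNge => /negP; apply.
rewrite -fsr mur; apply: le_measure; rewrite ?inE.
- exact: measurable_gt.
- exact: measurable_eball.
- move=> y /= ty; rewrite /eball/= ltNge; apply/negP => xy.
  by have := df _ _ xy; rewrite leNgt (le_lt_trans ft).
Qed.

(** By layer cake it suffices to compare levels: the part of {g > t} in [C] is at most as large as
    either set, and for concentric balls the intersection is the smaller one, so equality is
    attained. *)
Lemma integral_le_rearrangement g gs C r : measurable_fun setT g ->
  (forall x, 0 <= g x) -> measurable_fun setT gs -> is_rearrangement g gs ->
  measurable C -> mu C = mu (eball r) ->
  \int[mu]_(x in C) g x <= \int[mu]_(x in eball r) gs x.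
Proof.
move=> mg g0 mgs [gs0 gsE] mC Cr; have mB := @measurable_eball R d r.
rewrite integral_mkcond [leRHS]integral_mkcond.
have mgC : measurable_fun setT (g \_ C).
  by apply/(measurable_restrictT _ mC); exact: measurable_funTS.
have mgsB : measurable_fun setT (gs \_ (eball r)).
  by apply/(measurable_restrictT _ mB); exact: measurable_funTS.
have gC0 x : 0 <= (g \_ C) x by rewrite patchE; case: ifP.
have gsB0 x : 0 <= (gs \_ (eball r)) x by rewrite patchE; case: ifP.
have slE (D : set 'rV[R]_d) k t : (0 < t)%R ->
    superlevel (k \_ D) t = D `&` [set x | t%:E < k x].
  move=> t0; apply/seteqP; split => x; rewrite /superlevel/= patchE.
    case: ifPn => [/set_mem Dx []//|_ [_]].
    by rewrite lte_fin ltNge (ltW t0).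
  by move=> [Dx tx]; rewrite mem_set.
rewrite (layer_cake mgC gC0) (layer_cake mgsB gsB0).
apply: ge0_le_integral => //.
- exact: measurable_superlevel_measure.
- exact: measurable_superlevel_measure.
move=> t _; have [t0|t0] := ltP 0%R t; last first.
  rewrite (_ : superlevel (g \_ C) t = set0) ?measure0//.
  by apply/seteqP; split => // x [+ _]; rewrite ltNge t0.
rewrite !slE//; have [s s0 [gss mus]] := gsE t t0.
rewrite gss in mus *; have [rs|sr] := leP r s.
  rewrite (_ : eball r `&` eball s = eball r).
    apply: (@le_trans _ _ (mu C)); last by rewrite Cr.
    by apply: le_measure; rewrite ?inE//; apply: measurableI => //; exact: measurable_gt.
  by apply/seteqP; split => x; [case|move=> xr; split => //; exact: lt_le_trans xr rs].
rewrite (_ : eball r `&` eball s = eball s).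
  apply: (@le_trans _ _ (mu [set x | t%:E < g x])); last first.
    by have /eqP := esym mus; rewrite eq_le => /andP[].
  apply: le_measure; rewrite ?inE; last exact: subIsetr.
    by apply: measurableI => //; exact: measurable_gt.
  exact: measurable_gt.
by apply/seteqP; split => x; [case|move=> xs; split => //; exact: lt_trans xs sr].
Qed.

End rearrangement.

(** * Invariance of the entropy and conclusion *)

Section entropy_invariance.
Context (R : realType) (d : nat).
Local Notation mu := (@lebesgue_rV R d).
Implicit Types f g : 'rV[R]_d -> \bar R.

Let measurable_mul_lne f : measurable_fun setT f ->
  measurable_fun setT (fun x => f x * lne (f x)).
Proof.
by move=> mf; exact: (emeasurable_funM mf (measurableT_comp (measurable_lne (R := R)) mf)).
Qed.

Lemma renyi_entropy_ae_eq (a : R) f g :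
  measurable_fun setT f -> measurable_fun setT g -> ae_eq mu setT f g ->
  renyi_entropy a f = renyi_entropy a g.
Proof.
move=> mf mg fg; rewrite /renyi_entropy; case: ifP => _.
  congr (- _); apply: ae_eq_integral => //; try exact: measurable_mul_lne.
  by apply: filterS fg => x /= H xT; rewrite H.
congr (_ * lne _); apply: ae_eq_integral => //.
- exact: (measurableT_comp (measurable_poweR a) mf).
- exact: (measurableT_comp (measurable_poweR a) mg).
- by apply: filterS fg => x /= H xT; rewrite H.
Qed.

Let integral_shiftT (b : 'rV[R]_d) f : measurable_fun setT f -> (forall x, 0 <= f x) ->
  \int[mu]_x f (x + b)%R = \int[mu]_x f x.
Proof. exact: (ge0_integral_shift b measurableT). Qed.

Lemma renyi_entropy_shift (a : R) (b : 'rV[R]_d) f : measurable_fun setT f ->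
  renyi_entropy a (fun x => f (x + b)%R) = renyi_entropy a f.
Proof.
move=> mf; rewrite /renyi_entropy; case: ifP => _.
  have mk := measurable_mul_lne mf.
  (* The change of variables is available for nonnegative functions, so both parts are shifted
     separately. *)
  congr (- _); rewrite [LHS]integralE [RHS]integralE; congr (_ - _).
    rewrite -[RHS](integral_shiftT b (measurable_funepos mk) (@funepos_ge0 _ _ _)).
    by apply: eq_integral => x _; rewrite !funeposE.
  rewrite -[RHS](integral_shiftT b (measurable_funeneg mk) (@funeneg_ge0 _ _ _)).
  by apply: eq_integral => x _; rewrite !funenegE.
congr (_ * lne _).
apply: (integral_shiftT b (measurableT_comp (measurable_poweR a) mf)) => x.
exact: poweR_ge0.
Qed.

Lemma ae_eq_superlevel f g (t : R) : measurable_fun setT f -> measurable_fun setT g ->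
  ae_eq mu setT f g -> mu [set x | t%:E < f x] = mu [set x | t%:E < g x].
Proof.
move=> mf mg fg; have iE (k : 'rV[R]_d -> \bar R) : measurable_fun setT k ->
    mu [set x | t%:E < k x] =
    \int[mu]_x (\1_[set x : 'rV[R]_d | (t%:E < k x)%E] x : R)%:E.
  by move=> mk; rewrite integral_indic ?setIT//; exact: measurable_gt.
rewrite !iE//; apply: ae_eq_integral => //.
- by apply/measurable_EFinP; apply: measurable_indic; exact: measurable_gt.
- by apply/measurable_EFinP; apply: measurable_indic; exact: measurable_gt.
apply: filterS fg => x /= H xT; rewrite !indicE.
by congr ((_ : bool)%:R%:E); apply/idP/idP; rewrite !inE/= H.
Qed.

Lemma has_density_ae_eq d0 (Omega : measurableType d0) (P : probability Omega R)
    (Y : Omega -> 'rV[R]_d) f g :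
  has_density P Y f -> has_density P Y g -> ae_eq mu setT f g.
Proof.
move=> [mY mf f0 fE] [_ mg g0 gE]; apply: integral_ae_eq => //; last first.
  by move=> E _ mE; rewrite -fE// -gE.
apply/integrableP; split => //; under eq_integral do rewrite gee0_abs//.
by rewrite -fE// preimage_setT probability_setT ltry.
Qed.

Lemma has_density_integral1 d0 (Omega : measurableType d0) (P : probability Omega R)
    (Y : Omega -> 'rV[R]_d) f : has_density P Y f -> \int[mu]_x f x = 1.
Proof. by move=> [_ _ _ fE]; rewrite -fE// preimage_setT probability_setT. Qed.

End entropy_invariance.

Section comparison_of_densities.
Context (R : realType) (d : nat).
Local Notation mu := (@lebesgue_rV R d).
Context d0 (Omega : measurableType d0) (P : probability Omega R).

(* [T] is normalized to fix the origin by subtracting [T 0], hence the shift. *)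
Lemma sum_density_comparison (X W : {RV P >-> 'rV[R]_d}) (fX fW : 'rV[R]_d -> \bar R)
    (T : 'rV[R]_d -> 'rV[R]_d) :
  independent_vectors P X W ->
  has_density P X fX -> radially_symmetric fX -> unimodal fX ->
  has_density P W fW -> radially_symmetric fW -> unimodal fW ->
  euclidean_contraction T ->
  exists F G : 'rV[R]_d -> \bar R,
  [/\ has_density P (fun w => X w + W w)%R F,
      has_density P (fun w => T (X w) + W w)%R G,
      radially_decreasing F,
      (forall h, measurable_fun setT h -> (forall x, 0 <= h x) ->
        radially_decreasing h ->
        \int[mu]_x (h x * F x) <= \int[mu]_x (h x * G (x + T 0)%R)) &
      (forall h, measurable_fun setT h -> (forall x, 0 <= h x) ->
        radially_increasing h ->
        \int[mu]_x (h x * G (x + T 0)%R) <= \int[mu]_x (h x * F x))].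
Proof.
move=> indep dX symX uniX dW symW uniW cT.
have mT := measurable_contraction cT.
have dF := has_density_image_conv indep dX dW (T := id) (@measurable_id _ _ _).
have dG := has_density_image_conv indep dX dW mT.
have [_ mfX fX0 _] := dX; have [_ mfW fW0 _] := dW.
have decX := unimodal_radially_decreasing fX0 symX uniX.
have decW := unimodal_radially_decreasing fW0 symW uniW.
pose T' x := (T x - T 0)%R.
have mT' : measurable_fun setT T' by exact: measurable_rVB.
have T'_le x : (enorm (T' x) <= enorm x)%R.
  by apply: (le_trans (cT x 0%R)); rewrite subr0.
(* Since z - (T x - T 0) = (z + T 0) - T x, normalizing [T] only translates the density. *)
have G'E : image_conv fX fW T' = (fun z => image_conv fX fW T (z + T 0)%R).
  apply/funext => z; apply: eq_integral => x _; congr (fW _ * _).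
  by rewrite /T' opprB addrA.
have le_dec := integral_radially_decreasing mfX fX0 mfW fW0 decW mT' T'_le.
have le_inc := integral_radially_increasing mfX fX0 mfW fW0 decW mT' T'_le.
rewrite G'E in le_dec le_inc.
exists (image_conv fX fW id), (image_conv fX fW T).
split; [exact: dF|exact: dG| |exact: le_dec|exact: le_inc].
exact: image_conv_decreasing.
Qed.

(** The chain is: rearrangement of [f] on the ball, then [F], then the shifted [G], then [g] on the
    ball translated by [b], then the rearrangement of [g] on the centered ball. Only the second
    comparison uses [le_dec], for the indicator of a ball. *)
Lemma majorized_of_radial_comparison f g F G (b : 'rV[R]_d)
    (Y Z : Omega -> 'rV[R]_d) :
  has_density P Y f -> has_density P Y F ->
  has_density P Z g -> has_density P Z G -> radially_decreasing F ->
  (forall h, measurable_fun setT h -> (forall x, 0 <= h x) ->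
    radially_decreasing h ->
    \int[mu]_x (h x * F x) <= \int[mu]_x (h x * G (x + b)%R)) ->
  majorized f g.
Proof.
move=> f_density F_density g_density G_density dF le_dec.
have [_ mF F0 _] := F_density; have [_ mG G0 GE] := G_density.
have [_ mf f0 _] := f_density; have [_ mg g0 gE] := g_density.
have foo : \int[mu]_x f x < +oo by rewrite (has_density_integral1 f_density) ltry.
have goo : \int[mu]_x g x < +oo by rewrite (has_density_integral1 g_density) ltry.
have [fs mfs fsf] := rearrangement_exists mf f0 foo.
have [gs mgs gsg] := rearrangement_exists mg g0 goo.
exists fs, gs; split => // r r0.
(* A rearrangement depends only on the volumes of superlevel sets, so it is shared by almost
   everywhere equal densities. *)
have fsF : is_rearrangement F fs.
  case: fsf => fs0 fsf; split => // t t0.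
  have [s s0 [fss mus]] := fsf t t0; exists s => //; split => //.
  rewrite mus; apply: ae_eq_superlevel => //.
  exact: has_density_ae_eq f_density F_density.
have mB := @measurable_eball R d r.
have mC := measurable_preimageT (measurable_shift (- b)%R) mB.
pose G' x := G (x + b)%R.
have mG' : measurable_fun setT G' := measurableT_comp mG (measurable_shift b).
have G'0 x : 0 <= G' x by exact: G0.
have ballE k : \int[mu]_(x in eball r) k x =
    \int[mu]_x ((\1_(@eball R d r) x : R)%:E * k x).
  rewrite integral_mkcond; apply: eq_integral => x _.
  by rewrite patchE indicE; case: ifP => _; rewrite ?mul1e ?mul0e.
apply: (@le_trans _ _ (\int[mu]_(x in eball r) F x)).
  apply: ge0_le_integral => //.
  - by move=> x _; case: fsf.
  - exact: measurable_funTS.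
  - exact: measurable_funTS.
  - by move=> x _; exact: (rearrangement_le_radial mF F0 dF fsF).
apply: (@le_trans _ _ (\int[mu]_(x in eball r) G' x)).
  rewrite [leLHS]ballE [leRHS]ballE; apply: le_dec.
  - by apply/measurable_EFinP; exact: measurable_indic.
  - by move=> x; rewrite lee_fin.
  - move=> x y xy; rewrite lee_fin !indicE ler_nat.
    have [yr|//] := boolP (y \in eball r).
    by rewrite mem_set// /eball/=; apply: le_lt_trans xy _; exact: set_mem yr.
rewrite -[leLHS](ge0_integral_shift (- b)%R mB mG' G'0).
apply: (@le_trans _ _ (\int[mu]_(x in (fun x => x - b)%R @^-1` (@eball R d r)) g x)).
  (* The given density [g] is exchanged for [G] through the probability that [Z] lies in the
     translated ball. *)
  rewrite -[leRHS]gE// [leRHS]GE//.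
  by under eq_integral do rewrite /G' subrK.
apply: (integral_le_rearrangement mg g0 mgs gsg mC).
exact: (lebesgue_rV_translation (- b)%R mB).
Qed.

End comparison_of_densities.

Local Close Scope ereal_scope.

Theorem theorem2p4 (R : realType) (d : nat)
  (d0 : measure_display) (Omega : measurableType d0) (P : probability Omega R)
  (X W : {RV P >-> 'rV[R]_d}) (fX fW : 'rV[R]_d -> \bar R)
  (T : 'rV[R]_d -> 'rV[R]_d)
  (XW_indep : independent_vectors P X W)
  (X_density : has_density P X fX)
  (X_radial : radially_symmetric fX)
  (X_unimodal : unimodal fX)
  (W_density : has_density P W fW)
  (W_radial : radially_symmetric fW)
  (W_unimodal : unimodal fW)
  (T_contraction : euclidean_contraction T) :
  [/\ exists f, has_density P (fun w => X w + W w) f,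
      exists g, has_density P (fun w => T (X w) + W w) g &
      forall f g : 'rV[R]_d -> \bar R,
        has_density P (fun w => X w + W w) f ->
        has_density P (fun w => T (X w) + W w) g ->
        majorized f g /\
        forall alpha : R, 0 < alpha ->
          (renyi_entropy alpha g <= renyi_entropy alpha f)%E].
Proof.
have [F [G [dF dG decF le_dec le_inc]]] := sum_density_comparison XW_indep
  X_density X_radial X_unimodal W_density W_radial W_unimodal T_contraction.
split; [by exists F|by exists G|] => f g df dg.
split=> [|a a0].
  exact: majorized_of_radial_comparison df dF dg dG decF le_dec.
have [_ mf _ _] := df; have [_ mg _ _] := dg.
have [_ mF F0 _] := dF; have [_ mG G0 _] := dG.
(* Arbitrary densities are replaced by the explicit [F] and [G], and [G] by its translate, since the
   radial comparisons hold for that translate. *)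
rewrite (renyi_entropy_ae_eq a mf mF (has_density_ae_eq df dF)).
rewrite (renyi_entropy_ae_eq a mg mG (has_density_ae_eq dg dG)).
rewrite -(renyi_entropy_shift a (T 0) mG); apply: le_renyi_entropy => //.
- exact: (measurableT_comp mG (measurable_shift (T 0))).
- exact: has_density_integral1 dF.
- by rewrite -(has_density_integral1 dG); exact: (ge0_integral_shift (T 0) measurableT mG G0).
Qed.
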